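(* Let $D=7$ and consider $T^*\mathbb{R}^7$ with coordinates $(x_1,\dots,x_7,p_1,\dots,p_7)$ and the Hamiltonian $H$ given by $$2H=\left(p_1-\tfrac12x_2p_3-x_1x_2p_4-\tfrac12x_1^2x_2p_6-\tfrac14x_1x_2^2p_7\right)^2+\left(p_2+\tfrac12x_1p_3+x_1x_2p_5-\tfrac12x_1x_2^2p_6+\tfrac14x_1^2x_2p_7\right)^2,$$ which is the Hamiltonian of the left-invariant sub-Riemannian structure on the $(2,3,5,7)$-distribution specified in the context. Then for no degree $d\le 6$ does $H$ admit a final integral of degree $d$. That is, for each integer $1\le d\le 6$ there is no function of the form $$F=\sum_{|\tau|=d}a_\tau(x_1,x_2)\,p^\tau$$ with smooth coefficients $a_\tau$ such that $\{H,F\}=0$ and such that $H,p_3,p_4,p_5,p_6,p_7,F$ are functionally independent almost everywhere.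
   Context: $\{\cdot,\cdot\}$ is the Poisson bracket of the canonical symplectic structure on $T^*\mathbb{R}^7$. For a multi-index $\tau=(\tau_1,\dots,\tau_7)$ of non-negative integers, $p^\tau=\prod_{i=1}^7p_i^{\tau_i}$ and $|\tau|=\sum_i\tau_i$. The $(2,3,5,7)$-distribution in question is the left-invariant rank 2 distribution $\Delta=\langle e_1,e_2\rangle$ on the simply connected 7-dimensional Carnot group $G\cong\mathbb{R}^7$ whose Lie algebra $\langle e_1,\dots,e_7\rangle$ has the nontrivial brackets $$[e_1,e_2]=e_3,\ [e_1,e_3]=e_4,\ [e_2,e_3]=e_5,\ [e_1,e_4]=-[e_2,e_5]=e_6,\ [e_1,e_5]=[e_2,e_4]=e_7.$$ The left-invariant sub-Riemannian metric on $\Delta$ is the one with orthonormal frame $e_1,e_2$. Its Hamiltonian is $H=\frac12(\omega_1^2+\omega_2^2)$, where $\omega_i$ is the fiberwise linear function on $T^*G$ defined by the left-invariant vector field $e_i$. In suitable global coordinates $x_1,\dots,x_7$ on $G$ it takes the form displayed in the claim. The Hamiltonian does not depend on $x_3,\dots,x_7$, so $p_3,\dots,p_7$ are integrals. Together with $H$ they form an involutive family of 6 functionally independent integrals. A ''final integral of degree $d$'' is one more integral completing this family to a Liouville integrable one: a function $F$ on $T^*G$, smooth in the base variables and homogeneous polynomial of degree $d$ in the momenta, which Poisson-commutes with $H,p_3,\dots,p_7$ and is such that $H,p_3,\dots,p_7,F$ are functionally independent almost everywhere. Commuting with $p_3,\dots,p_7$ means precisely that the coefficients of $F$ depend on $x_1,x_2$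 only. *)

(* Defs.v *)
From HB Require Import structures.
From mathcomp Require Import all_boot all_order all_algebra.
From mathcomp Require Import all_classical all_reals all_analysis.

Set Implicit Arguments.
Unset Strict Implicit.
Unset Printing Implicit Defensive.

Import Order.TTheory GRing.Theory Num.Theory.
Import numFieldNormedType.Exports.

Local Open Scope classical_set_scope.
Local Open Scope ring_scope.

Definition partial (R : realType) (n : nat) (i : 'I_n) (f : 'rV[R]_n -> R) :
    'rV[R]_n -> R :=
  fun x => 'D_(delta_mx 0 i) f x.

(* C^oo: partial derivatives of every order exist and are continuous. *)
Definition smooth (R : realType) (n : nat) (f : 'rV[R]_n -> R) : Prop :=
  forall s : seq 'I_n,
    let g := foldr (@partial R n) f s in
    continuous g /\
    (forall (i : 'I_n) (x : 'rV[R]_n), derivable g x (delta_mx 0 i)).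

(* T^*R^n is 'rV[R]_(n + n): base coordinates first, then momenta. The sign is
   the one for which {p_i, x_i} = 1, so that X |-> <p, X> is a morphism from
   vector fields with the Lie bracket. *)
Definition poisson (R : realType) (n : nat) (F G : 'rV[R]_(n + n) -> R) :
    'rV[R]_(n + n) -> R :=
  fun z => \sum_(i < n)
    (partial (rshift n i) F z * partial (lshift n i) G z
     - partial (lshift n i) F z * partial (rshift n i) G z).

(* Lebesgue null sets of R^n, by countable covers with closed boxes. *)
Definition null_set (R : realType) (n : nat) (A : set 'rV[R]_n) : Prop :=
  forall eps : R, 0 < eps ->
    exists l u : nat -> 'rV[R]_n,
      [/\ forall k i, l k 0 i <= u k 0 i,
          A `<=` \bigcup_k [set z | forall i, l k 0 i <= z 0 i <= u k 0 i]
        & (\sum_(0 <= k <oo) (\prod_(i < n) (u k 0 i - l k 0 i))%:E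
             <= eps%:E)%E].

(* The columns of the Jacobian matrix are the differentials of the f_j. *)
Definition independent_at (R : realType) (n k : nat)
    (f : k.-tuple ('rV[R]_n -> R)) (z : 'rV[R]_n) : Prop :=
  \rank (jacobian (fun y => \row_(j < k) tnth f j y) z) = k.

Definition independent_ae (R : realType) (n k : nat)
    (f : k.-tuple ('rV[R]_n -> R)) : Prop :=
  null_set [set z | ~ independent_at f z].

(* Coordinates on T^*R^7, numbered from 1; meaningful for 1 <= k <= 7. *)
Definition x_ (R : realType) (k : nat) (z : 'rV[R]_(7 + 7)) : R :=
  z 0 (lshift 7 (inord k.-1)).

Definition p_ (R : realType) (k : nat) (z : 'rV[R]_(7 + 7)) : R :=
  z 0 (rshift 7 (inord k.-1)).

(* The squared terms are the momentum functions omega_1, omega_2 of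
     e1 = d1 - x2/2 d3 - x1 x2 d4 - x1^2 x2/2 d6 - x1 x2^2/4 d7,
     e2 = d2 + x1/2 d3 + x1 x2 d5 - x1 x2^2/2 d6 + x1^2 x2/4 d7,
   which generate the Carnot algebra of growth (2,3,5,7) with
   [e1,e2] = e3, [e1,e3] = e4, [e2,e3] = e5, [e1,e4] = -[e2,e5] = e6 and
   [e1,e5] = [e2,e4] = e7. *)
Definition H2357 (R : realType) (z : 'rV[R]_(7 + 7)) : R :=
  let x1 := x_ 1 z in let x2 := x_ 2 z in
  2^-1 *
  ((p_ 1 z - 2^-1 * x2 * p_ 3 z - x1 * x2 * p_ 4 z
      - 2^-1 * x1 ^+ 2 * x2 * p_ 6 z - 4^-1 * x1 * x2 ^+ 2 * p_ 7 z) ^+ 2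
   + (p_ 2 z + 2^-1 * x1 * p_ 3 z + x1 * x2 * p_ 5 z
      - 2^-1 * x1 * x2 ^+ 2 * p_ 6 z + 4^-1 * x1 ^+ 2 * x2 * p_ 7 z) ^+ 2).

(* Multi-indices tau with |tau| = d have all their components at most d. *)
Definition multi_index (d : nat) := {ffun 'I_7 -> 'I_d.+1}.

Definition weight (d : nat) (tau : multi_index d) : nat :=
  (\sum_(i < 7) tau i)%N.

Definition momentum_poly (R : realType) (d : nat)
    (a : multi_index d -> 'rV[R]_2 -> R) (z : 'rV[R]_(7 + 7)) : R :=
  \sum_(tau : multi_index d | weight tau == d)
     a tau (\row_(j < 2) x_ j.+1 z) * \prod_(i < 7) p_ i.+1 z ^+ tau i.

(* Main.v *)
(** Fix the values [q] of [p_3, ..., p_7]. In terms of the velocities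
    [v = (omega_1, omega_2)] the flow of [H] is that of a charged particle in the
    plane, in a magnetic field [b] which is a harmonic quadratic polynomial in
    [x_1, x_2], and an integral is a polynomial [F = sum g_ij v_1^i v_2^j] with
    [v . dF + b (v_1 d/dv_2 - v_2 d/dv_1) F = 0].

    Integrating this equation in [x_1] alone, by decreasing degree in [v], shows
    that the [g_ij] are polynomials in [x_1], and likewise in [x_2]; so everything
    can be complexified. Put [y = x_1 + i x_2], [y' = x_1 - i x_2], centred so that
    [b = c y^2 + c' y'^2 + e_0]. The restrictions [f_n] of the homogeneous
    components of [F] to an isotropic vector satisfy
    [d f_n / dy = lam_n b f_{n+1}], so for fixed [y'] the polynomial [f_0] is a
    polynomial in the primitive [zeta = c y^3/3 + e y] of [b], where
    [e = c' y'^2 + e_0]. On the other hand the equation in degrees 1 and 2 forces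
    [f_0 = P(b)]. Since [zeta] vanishes both where [b = e] and where [b = - 2 e], we
    get [P(e) = P(- 2 e)] for all [e], and [P] is constant. Then all the other [f_n]
    vanish, [F - f_0] is divisible by [v_1^2 + v_2^2], the quotient is again an
    integral, and by induction [F] is a polynomial in [v_1^2 + v_2^2] with constant
    coefficients.

    Hence [F] is a polynomial in [H, p_3, ..., p_7], the seven differentials are
    everywhere dependent, and the whole space is not a null set. *)

Require Import Defs.
From HB Require Import structures.
From mathcomp Require Import all_boot all_order all_algebra.
From mathcomp Require Import all_classical all_reals all_analysis.
From mathcomp Require Import measurable_realfun qpoly complex ring lra zify.

Set Implicit Arguments.
Unset Strict Implicit.
Unset Printing Implicit Defensive.

Import Order.TTheory GRing.Theory Num.Theory.
Import numFieldNormedType.Exports.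

Local Open Scope ring_scope.

(** * Polynomial preliminaries: antiderivatives, extensionality, derivations *)

Lemma deriv0_const (R : numDomainType) (p : {poly R}) : p^`() = 0 -> p = (p`_0)%:P.
Proof.
move=> dp; apply/polyP => -[|i]; rewrite coefC //=.
have /eqP := congr1 (fun q : {poly R} => q`_i) dp.
by rewrite coef_deriv coef0 mulrn_eq0 /= => /eqP.
Qed.

(* The constant coefficient is the junk value [p`_0 / 0 = 0]. *)
Definition antideriv (R : numFieldType) (p : {poly R}) : {poly R} :=
  \poly_(i < (size p).+1) (p`_i.-1 / i%:R).

Lemma antiderivK (R : numFieldType) (p : {poly R}) : (antideriv p)^`() = p.
Proof.
apply/polyP => i; rewrite coef_deriv coef_poly ltnS.
case: ltnP => [_|le_pi]; last by rewrite mul0rn nth_default.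
by rewrite -(mulr_natr (_ / _)) divfK ?pnatr_eq0.
Qed.

(** By descending induction on [n]: if [f n.+1 = Q \Po zeta], then [f n] and [lam n] times an
    antiderivative of [Q] composed with [zeta] have the same derivative, so they differ by a
    constant. *)
Lemma chain_comp (K : numFieldType) (lam : nat -> K) (zeta : {poly K})
    (N : nat) (f : nat -> {poly K}) :
    (forall n, (f n)^`() = lam n *: (zeta^`() * f n.+1)) ->
    (forall n, (N <= n)%N -> f n = 0) ->
  forall n, exists Q, f n = Q \Po zeta.
Proof.
move=> fS f0 n; have [k] := ubnP (N - n); elim: k n => // k IHk n.
case: (leqP N n) => [/f0-> _|lt_nN le_k].
  by exists 0; rewrite comp_poly0.
have [|Q fQ] := IHk n.+1; first by lia.
pose S := lam n *: antideriv Q.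
exists (S + ((f n - (S \Po zeta))`_0)%:P).
rewrite comp_polyD comp_polyC -deriv0_const; first by rewrite addrC subrK.
rewrite derivB deriv_comp derivZ antiderivK fS fQ comp_polyZ.
by rewrite -scalerAl [zeta^`() * _]mulrC subrr.
Qed.

Lemma poly_nat_eq0 (R : numDomainType) (p : {poly R}) :
  (forall n : nat, p.[n%:R] = 0) -> p = 0.
Proof.
move=> p0; apply/eqP; apply: contraT => pN0.
have /max_poly_roots : all (root p) [seq n%:R | n <- iota 0 (size p)].
  by apply/allP => _ /mapP[n _ ->]; apply/rootP.
move/(_ pN0); rewrite size_map size_iota ltnn; apply.
by rewrite map_inj_uniq ?iota_uniq // => m n /eqP; rewrite eqr_nat => /eqP.
Qed.

Lemma poly_ext (R : numDomainType) (p q : {poly R}) : (forall x, p.[x] = q.[x]) -> p = q.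
Proof.
by move=> pq; apply/subr0_eq/poly_nat_eq0 => n; rewrite hornerD hornerN pq subrr.
Qed.

Lemma poly2_ext (R : numDomainType) (p q : {poly {poly R}}) :
  (forall y x, p.[y%:P].[x] = q.[y%:P].[x]) -> p = q.
Proof.
move=> pq; apply/polyP => i; apply: poly_ext => x.
suff /(congr1 (fun r : {poly R} => r`_i)) : map_poly (horner_eval x) p = map_poly
  (horner_eval x) q.
  by rewrite !coef_map.
apply: poly_ext => y; have ev (r : {poly {poly R}}) : (map_poly (horner_eval x) r).[y] =
  r.[y%:P].[x].
  by have := horner_map (horner_eval x) r y%:P; rewrite /= /horner_eval hornerC.
by rewrite !ev.
Qed.

Lemma map_poly_derivation (B : comNzRingType) (D : {additive B -> B}) (p q : {poly B}) :
    (forall a b, D (a * b) = D a * b + a * D b) ->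
  map_poly D (p * q) = map_poly D p * q + p * map_poly D q.
Proof.
move=> DM; apply/polyP => i; rewrite coef_map coefD !coefM raddf_sum -big_split /=.
by apply: eq_bigr => j _; rewrite DM !coef_map.
Qed.

(** [x] is a constant of [D], so [D] acts on the coefficients only. *)
Lemma horner_map_derivation (B : comNzRingType) (D : {additive B -> B}) (p : {poly B}) (x : B) :
    (forall a b, D (a * b) = D a * b + a * D b) -> D x = 0 ->
  (map_poly D p).[x] = D p.[x].
Proof.
move=> DM Dx; have D1 : D 1 = 0.
  by have /eqP := DM 1 1; rewrite !mulr1 mul1r addrC -subr_eq subrr eq_sym => /eqP.
have Dxn n : D (x ^+ n) = 0.
  by elim: n => // n IHn; rewrite exprS DM Dx IHn mul0r mulr0 addr0.
rewrite (horner_coef_wide _ (size_poly _ _)) horner_coef raddf_sum.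
by apply: eq_bigr => i _; rewrite coef_map DM Dxn mulr0 addr0.
Qed.

(** * Polynomials in the isotropic coordinates *)

Section Bivariate.
Variable K : numClosedFieldType.
Local Notation A := {poly {poly K}}.
Implicit Types (p q f : A).

(* In [{poly {poly K}}] the outer variable is [y] and the inner one is [y']. *)
Definition bicst (k : K) : A := k%:P%:P.
Definition derivin p : A := map_poly (@deriv K) p.

Lemma coef_derivin p i : (derivin p)`_i = (p`_i)^`().
Proof. by rewrite coef_map. Qed.

Lemma derivinD p q : derivin (p + q) = derivin p + derivin q.
Proof. exact: raddfD. Qed.

Lemma derivinM p q : derivin (p * q) = derivin p * q + p * derivin q.
Proof. by apply: map_poly_derivation => a b; rewrite /= derivM. Qed.

HB.instance Definition _ := GRing.Additive.copy derivin (map_poly (@deriv K)).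

Lemma derivinC (r : {poly K}) : derivin r%:P = (r^`())%:P.
Proof. by rewrite /derivin map_polyC. Qed.

Lemma derivinX : derivin 'X = 0.
Proof. by apply/polyP => i; rewrite coef_derivin coefX coef0; case: eqP => _; rewrite
  -polyC_natr derivC. Qed.

Lemma deriv_derivin p : (derivin p)^`() = derivin p^`().
Proof.
by apply/polyP => i; rewrite coef_deriv !coef_derivin coef_deriv derivMn.
Qed.

Section Quadric.
Variables (c c' e0 : K).
Hypotheses (c_neq0 : c != 0) (c'_neq0 : c' != 0).

Definition quadric : A := bicst c * 'X^2 + (c' *: 'X^2 + e0%:P)%:P.

(* Up to a factor, the Hamiltonian vector field of the quadric. *)
Definition rot p : A := bicst c' * ('X)%:P * p^`() - bicst c * 'X * derivin p.

Lemma rotD p q : rot (p + q) = rot p + rot q.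
Proof. rewrite /rot derivD derivinD; ring. Qed.

Lemma rotM p q : rot (p * q) = rot p * q + p * rot q.
Proof. rewrite /rot derivM derivinM; ring. Qed.

Lemma rot_cst k : rot (bicst k) = 0.
Proof. by rewrite /rot /bicst derivinC !derivC !mulr0 subrr. Qed.

(** The coefficient of y^j y'^k in [rot p = 0] links the coefficients of [p] at (j + 1, k - 1) and
    (j - 1, k + 1); the conditionals give 0 when an index would be negative. *)
Lemma rot_coef p j k : rot p = 0 ->
  c' * (if k is k'.+1 then p`_j.+1`_k' *+ j.+1 else 0)
  = c * (if j is j'.+1 then p`_j'`_k.+1 *+ k.+1 else 0).
Proof.
move=> /subr0_eq/(congr1 (fun q : A => q`_j`_k)).
rewrite /bicst -!mulrA !coefCM coefXM coefXM coef_deriv.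
by case: j k => [|j] [|k]; rewrite /= ?coef0 ?mulr0 ?coefMn ?coef_derivin ?coef_deriv.
Qed.

(** The relation of [rot_coef] moves [k] in steps of 2, starting from 0 at [k = 1]. *)
Lemma rot_odd p j k : rot p = 0 -> odd k -> p`_j`_k = 0.
Proof.
move=> rp; have [m] := ubnP k; elim: m k j => // m IHm [|[|k]] j // ltkm.
  move=> _; have /esym/eqP := rot_coef j.+1 0 rp.
  by rewrite mulr0 mulf_eq0 (negPf c_neq0) /= => /eqP.
rewrite /= negbK => ok; have /esym := rot_coef j.+1 k.+1 rp.
by rewrite (IHm k _ (ltnW ltkm) ok) mul0rn mulr0 => /eqP; rewrite mulf_eq0 (negPf c_neq0)
  mulrn_eq0 /= => /eqP.
Qed.

(** The coefficient of y^(j+2) is determined by that of y^j, and the coefficient of y vanishes. *)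
Lemma rot_eq0 p : rot p = 0 -> p`_0 = 0 -> p = 0.
Proof.
move=> rp p0; apply/polyP => j; apply/polyP => k; rewrite !coef0.
have [m] := ubnP j; elim: m j k => // m IHm [|[|j]] k ltjm.
- by rewrite p0 coef0.
- have /eqP := rot_coef 0 k.+1 rp.
  by rewrite mulr0 mulf_eq0 (negPf c'_neq0) /= => /eqP.
- have := rot_coef j.+1 k.+1 rp.
  by rewrite (IHm j _ (ltnW ltjm)) mul0rn mulr0 => /eqP; rewrite mulf_eq0 (negPf c'_neq0)
    mulrn_eq0 /= => /eqP.
Qed.

(** By [rot_eq0] it suffices to match [p] at y = 0, where by [rot_odd] only even powers of y' occur.
    The invariant [s] restricts there to y'^2. *)
Lemma rot_quadric p : rot p = 0 ->
  exists P : {poly K}, forall y w, p.[y%:P].[w] = P.[c * y ^+ 2 + c' * w ^+ 2 + e0].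
Proof.
move=> rp; pose s : A := bicst (c / c') * 'X^2 + ('X^2)%:P.
have rs : rot s = 0.
  rewrite /rot /s derivD derivinD derivM derivinM derivC /bicst !derivinC !derivC derivXn.
  rewrite expr2 derivinM derivinX derivXn /= expr1 mulr0 !mul0r !add0r !addr0.
  have -> : ('X *+ 2 : {poly K})%:P = 'X%:P *+ 2 :> A by rewrite polyCMn.
  have -> : c%:P%:P = c'%:P%:P * (c / c')%:P%:P :> A.
    by rewrite -!polyCM mulrC divfK.
  ring.
have rsk k : rot (s ^+ k) = 0.
  elim: k => [|k IHk]; first exact: rot_cst.
  by rewrite exprS rotM rs IHk mul0r mulr0 addr0.
pose n := size p`_0.
pose q : A := \sum_(k < n) bicst p`_0`_k.*2 * s ^+ k.
have pq : p = q.
  apply/eqP; rewrite -subr_eq0; apply/eqP/rot_eq0.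
    have rN : rot (- q) = - rot q by rewrite /rot derivN /derivin raddfN; ring.
    rewrite rotD rp rN add0r /q; apply/eqP; rewrite oppr_eq0; apply/eqP.
    elim/big_ind: _ => [||k _]; first exact: (rot_cst 0).
      by move=> x y rx ry; rewrite rotD rx ry addr0.
    by rewrite rotM rot_cst rsk mul0r mulr0 addr0.
  rewrite coefB -[q`_0]horner_coef0 /q horner_sum.
  apply/polyP => l; rewrite coefB coef0 coef_sum.
  under eq_bigr => k _ do
    rewrite hornerM horner_exp {1}/bicst hornerC {1}/s hornerD hornerM {1}/bicst !hornerC
      hornerXn expr0n mulr0 add0r -exprM mul2n coefCM coefXn.
  have [ol|el] := boolP (odd l).
    rewrite (rot_odd _ rp ol) big1 ?subrr // => k _.
    by case: eqP ol => [->|_ _]; rewrite ?odd_double ?mulr0.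
  have lE : l = (l./2).*2 by rewrite even_halfK.
  case: (ltnP l./2 n) => [ltl|gel].
    rewrite (bigD1 (Ordinal ltl)) //= -lE eqxx mulr1 big1 ?addr0 ?subrr // => k.
    rewrite -val_eqE /= => nk; case: eqP => [E|_]; last by rewrite mulr0.
    by rewrite E doubleK eqxx in nk.
  rewrite nth_default; last by rewrite -/n; lia.
  rewrite big1 ?subrr // => k _; case: eqP => [E|_]; last by rewrite mulr0.
  by move: (ltn_ord k) gel; rewrite E doubleK => /leq_trans/[apply]; rewrite ltnn.
(* This substitutes s = (quadric - e0) / c'. *)
exists (\sum_(k < n) p`_0`_k.*2 *: (c'^-1 *: ('X - e0%:P)) ^+ k) => y w.
rewrite {1}pq /q !horner_sum; apply: eq_bigr => k _.
rewrite hornerM horner_exp /bicst hornerC hornerM horner_exp hornerC hornerZ horner_exp.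
congr (_ * _ ^+ _).
rewrite /s /bicst hornerD hornerM !hornerC hornerXn hornerD hornerM hornerC horner_exp hornerC.
rewrite hornerXn hornerZ hornerD hornerX hornerN hornerC; field; exact: c'_neq0.
Qed.

(** Comparing coefficients gives P_k = a^k P_k. *)
Lemma poly_dilation_const (P : {poly K}) (a : K) :
    (forall n, (0 < n)%N -> a ^+ n != 1) -> (forall e, P.[e] = P.[a * e]) ->
  P = (P`_0)%:P.
Proof.
move=> a1 Pa; apply/polyP => -[|k]; rewrite coefC //=.
have /(congr1 (fun q : {poly K} => q`_k.+1)) : P = P \Po (a *: 'X).
  by apply: poly_ext => e; rewrite horner_comp hornerZ hornerX.
rewrite coef_comp_poly => E; apply/eqP; move/eqP: E; rewrite -subr_eq0.
have [ltk|gek] := ltnP k.+1 (size P); last by rewrite nth_default ?eqxx.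
rewrite (bigD1 (Ordinal ltk)) //= exprZn coefZ coefXn eqxx mulr1 big1 => [|i].
  rewrite addr0 -{1}[P`__]mulr1 -mulrBr mulf_eq0 subr_eq0 [1 == _]eq_sym.
  by rewrite (negPf (a1 _ _)) ?orbF.
rewrite -val_eqE /= => ni; rewrite exprZn coefZ coefXn eq_sym (negPf ni).
by rewrite !mulr0.
Qed.

(** [f n] stands for the restriction of F_n to the isotropic vector (1, - i), and [g] for that of
    F_1 to (1, i). The fourth hypothesis is the equation for F_0, which has the same value at both
    vectors; the fifth is a combination of the degree 2 equations free of the field. *)
Lemma chain_const (lam : nat -> K) (N : nat) (f : nat -> A) (g : A) :
    (forall n, lam n != 0) ->
    (forall n, (f n)^`() = bicst (lam n) * (quadric * f n.+1)) ->
    (forall n, (N <= n)%N -> f n = 0) ->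
    derivin (f 0) = - bicst (lam 0) * (quadric * g) ->
    g^`() + derivin (f 1) = 0 ->
  (exists k, f 0 = bicst k) /\ forall n, f n.+1 = 0.
Proof.
move=> lam0 fS fN fg gf.
have cst0 k : k != 0 -> bicst k != 0 by move=> k0; rewrite /bicst !polyC_eq0.
have b0 : quadric != 0.
  apply/eqP => /(congr1 (fun q : A => q`_2)) /eqP.
  by rewrite coefD /bicst coefCM coefXn coefC /= mulr1 addr0 coef0 polyC_eq0 (negPf c_neq0).
have db : quadric^`() = bicst c * 'X *+ 2.
  by rewrite /quadric derivD derivC /bicst deriv_mulC derivXn /=; ring.
have db' : derivin quadric = bicst c' * ('X)%:P *+ 2.
  rewrite /quadric derivinD derivinM !derivinC expr2 derivinM !derivinX derivD !derivC
    derivZ derivXn /=.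
  by rewrite -mul_polyC polyCD polyCM polyCMn; ring.
(* This equates the mixed derivatives of [f 0]; the terms in which the quadric is not differentiated
   cancel by [gf]. *)
have fbg : derivin quadric * f 1 + quadric^`() * g = 0.
  apply: (mulfI (cst0 _ (lam0 0))); rewrite mulr0.
  have := deriv_derivin (f 0); rewrite fg fS.
  rewrite mulNr derivN !derivM derivinM /bicst !derivinC !derivC -/(bicst _) derivinM.
  move/eqP; rewrite -subr_eq0 => /eqP E.
  have -> : derivin quadric * f 1 + quadric^`() * g =
     derivin quadric * f 1 + quadric^`() * g + quadric * (g^`() + derivin (f 1)).
    by rewrite gf mulr0 addr0.
  by rewrite -[RHS]oppr0 -E; ring.
(* [2 * rot (f 0)] is [lam 0 * quadric] times the left-hand side of [fbg]. *)
have rf : rot (f 0) = 0.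
  apply: (mulfI (cst0 2 _)); first by rewrite pnatr_eq0.
  have c2 : bicst 2 = 2%:R by rewrite /bicst !polyC_natr.
  rewrite mulr0 -[RHS](mulr0 (bicst (lam 0) * quadric)) -fbg /rot fg fS db db' c2; ring.
have [P fP] := rot_quadric rf.
(* At [y' = w] the primitive [zeta] of the quadric vanishes both at [0], where the
   quadric is [e], and at [y], where it is [- 2 * e]. *)
have P2 e : P.[e] = P.[- 2 * e].
  pose w := sqrtC ((e - e0) / c'); pose y := sqrtC (- 3 * e / c).
  have we : c' * w ^+ 2 + e0 = e by rewrite sqrtCK; field.
  have ye : c * y ^+ 2 = - 3 * e by rewrite sqrtCK; field.
  pose zeta : {poly K} := (c / 3) *: 'X^3 + e *: 'X.
  have dzeta : zeta^`() = map_poly (horner_eval w) quadric.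
    rewrite /zeta /quadric derivD !derivZ derivX derivXn rmorphD rmorphM /= map_polyC.
    rewrite map_polyXn map_polyC /= /horner_eval hornerC hornerD hornerZ hornerXn hornerC we.
    by rewrite -(scaler_nat 3 ('X^2 : {poly K})) scalerA divfK ?pnatr_eq0 // alg_polyC
      mul_polyC.
  have [||Q fQ] := @chain_comp K lam zeta N (fun n => map_poly (horner_eval w) (f n)) _ _ 0.
  - move=> n; rewrite deriv_map fS !rmorphM /= map_polyC /= /horner_eval hornerC.
    by rewrite -dzeta mul_polyC.
  - by move=> n /fN->; rewrite rmorph0.
  have ev x : (f 0).[x%:P].[w] = Q.[zeta.[x]].
    have := horner_map (horner_eval w) (f 0) x%:P.
    by rewrite fQ /= /horner_eval hornerC horner_comp.
  have := ev y; have := ev 0.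
  have z0 : zeta.[0] = 0 by rewrite /zeta hornerD !hornerZ hornerX hornerXn expr0n !mulr0 addr0.
  have zy : zeta.[y] = 0.
    rewrite /zeta hornerD !hornerZ hornerX hornerXn.
    have -> : c / 3 * y ^+ 3 + e * y = (c * y ^+ 2 + 3 * e) / 3 * y by field.
    by rewrite ye mulNr addNr !mul0r.
  rewrite z0 zy !fP => <-.
  rewrite expr0n mulr0 add0r we -addrA we ye => <-.
  by congr (_.[_]); ring.
have Pc : P = (P`_0)%:P.
  apply: (poly_dilation_const _ P2) => n n0.
  have : 1 < `|- 2 : K| ^+ n by rewrite exprn_egt1 -?lt0n // normrN normr_nat ltr1n.
  by rewrite -normrX; apply: contraTneq => ->; rewrite normr1 ltxx.
have f0c : f 0 = bicst P`_0.
  apply: poly2_ext => y w; by rewrite fP {1}Pc /bicst !hornerC.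
split; first by exists P`_0.
(* As soon as [f n] is constant, [lam n * quadric * f n.+1 = 0] in an integral domain. *)
elim=> [|n IHn].
  have := fS 0; rewrite f0c /bicst derivC => /esym/eqP.
  by rewrite !mulf_eq0 (negPf (cst0 _ (lam0 0))) (negPf b0) => /eqP.
have := fS n.+1; rewrite IHn derivC => /esym/eqP.
by rewrite !mulf_eq0 (negPf (cst0 _ (lam0 _))) (negPf b0) => /eqP.
Qed.

End Quadric.

End Bivariate.

(** * The integral equation, degree by degree in the velocities *)

Section TransportOperator.
Variable B : comNzRingType.
Variables (s b n : B) (P Q V : {poly B}).

(* The equation [v . dF + b (v_1 d/dv_2 - v_2 d/dv_1) F = 0] in degree [m + 1],
   dehomogenized by [v = (1, 'X)]: [P] and [Q] are the derivatives of the component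
   [F_m] in [y] and [y'], [V] is the component [F_(m+1)], [s = i] and [n = m + 1]. *)
Definition transport : {poly B} :=
  (1 + s%:P * 'X) * P + (1 - s%:P * 'X) * Q
  + b%:P * ((1 + 'X^2) * V^`() - n%:P * 'X * V).

Lemma horner_transport x :
  transport.[x] = (1 + s * x) * P.[x] + (1 - s * x) * Q.[x]
    + b * ((1 + x ^+ 2) * V^`().[x] - n * x * V.[x]).
Proof. by rewrite /transport !hornerE. Qed.

Lemma coef0_transport : transport`_0 = P`_0 + Q`_0 + b * V`_1.
Proof.
rewrite /transport !mulrDl !mul1r mulNr -!mulrA !(coefD, coefN, coefCM, coefXM, coefXnM).
by rewrite coef_deriv /=; ring.
Qed.

Lemma coef2_transport :
  transport`_2 = P`_2 + Q`_2 + s * (P`_1 - Q`_1) + b * (V`_3 *+ 3 + V`_1 - n * V`_1).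
Proof.
rewrite /transport !mulrDl !mul1r mulNr -!mulrA !(coefD, coefN, coefCM, coefXM, coefXnM).
by rewrite !coef_deriv /=; ring.
Qed.

End TransportOperator.

(** [1 + 'X^2] is v_1^2 + v_2^2 at v = (1, 'X), which the rotation v_1 d/dv_2 - v_2 d/dv_1
    annihilates; multiplication by it raises the degree by 2, whence [n + 2]. *)
Lemma transportM (B : comNzRingType) (s b n : B) (P Q V : {poly B}) :
  transport s b (n + 2) ((1 + 'X^2) * P) ((1 + 'X^2) * Q) ((1 + 'X^2) * V)
  = (1 + 'X^2) * transport s b n P Q V.
Proof.
by rewrite /transport derivM derivD derivC derivXn polyCD /= polyC_natr; ring.
Qed.

Lemma map_derivation_1X2 (B : comNzRingType) (D : {additive B -> B}) (p : {poly B}) :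
    (forall x y, D (x * y) = D x * y + x * D y) ->
  map_poly D ((1 + 'X^2) * p) = (1 + 'X^2) * map_poly D p.
Proof.
move=> DM; have D1 : D 1 = 0.
  by have /eqP := DM 1 1; rewrite !mulr1 mul1r addrC -subr_eq subrr eq_sym => /eqP.
rewrite map_poly_derivation // (_ : map_poly D (1 + 'X^2) = 0) ?mul0r ?add0r //.
apply/polyP => i; rewrite coef_map coefD coef1 coefXn coef0 raddfD /=.
by case: eqP => _; case: eqP => _; rewrite ?raddf0 ?D1 ?addr0.
Qed.

(** * Descent by division by v_1^2 + v_2^2 *)

Section TowerOfPolynomials.
Variable K : numClosedFieldType.
Local Notation A := {poly {poly K}}.
Implicit Types (p q f : A).
Definition tricst (k : K) : {poly A} := (bicst k)%:P.

Lemma bicstN k : bicst (- k) = - bicst k :> A.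
Proof. by rewrite /bicst !raddfN. Qed.

Lemma bicstD k l : bicst (k + l) = bicst k + bicst l :> A.
Proof. by rewrite /bicst !polyCD. Qed.

Lemma bicstM k l : bicst (k * l) = bicst k * bicst l :> A.
Proof. by rewrite /bicst !polyCM. Qed.

(** The roots i and - i of [1 + 'X^2] differ by a nonzero constant, so both linear factors can be
    split off. *)
Lemma divide_1X2 (p : {poly A}) : p.[bicst 'i] = 0 -> p.[bicst (- 'i)] = 0 ->
  exists2 q, p = (1 + 'X^2) * q & (size q <= size p - 2)%N.
Proof.
move=> /rootP pi; have /factor_theorem[r ->] := pi.
rewrite hornerM hornerXsubC bicstN => /eqP; rewrite mulf_eq0 orbC -opprD oppr_eq0.
rewrite /bicst -!polyCD !polyC_eq0 -mulr2n mulrn_eq0 (negPf (neq0Ci _)) /= => ri.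
have /factor_theorem[q ->] : root r (bicst (- 'i)) by rewrite bicstN rootE.
have E : q * ('X - (bicst (- 'i))%:P) * ('X - (bicst 'i)%:P) = (1 + 'X^2) * q.
  rewrite bicstN.
  have i2 : (@bicst K 'i)%:P * (@bicst K 'i)%:P = - 1 :> {poly A}.
    by rewrite -polyCM -bicstM -[in bicst _]expr2 sqrCi bicstN polyCN /bicst !polyC1.
  move: i2; rewrite polyCN; move: (@bicst K 'i)%:P => j j2.
  have -> : q * ('X - - j) * ('X - j) = ('X^2 - j * j) * q by ring.
  by rewrite j2 opprK [_ + 1]addrC.
exists q; first exact: E.
have [->|q0] := eqVneq q 0; first by rewrite size_poly0.
have s3 : size (1 + 'X^2 : {poly A}) = 3 by rewrite addrC -[1]polyC1 size_XnaddC.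
by rewrite E size_mul // -?size_poly_eq0 s3 //= subn2.
Qed.

Section Tower.
Variables (c c' e0 : K).
Hypotheses (c_neq0 : c != 0) (c'_neq0 : c' != 0).
Local Notation b := (quadric c c' e0).

(** The degree [m + 1] part of the integral equation, [F m] being the component of degree [m] at v =
    (1, 'X). *)
Definition tower_eq (F : nat -> {poly A}) m :=
  transport (bicst 'i) b m.+1%:R (map_poly (@deriv {poly K}) (F m))
    (map_poly (@derivin K) (F m)) (F m.+1) = 0.

(** By induction on [N]: F_0 is constant and the other components vanish at both isotropic vectors,
    at - i by [chain_const] and at i by [ep]. So F_1 = 0 and F_(m+2) = (1 + 'X^2) G_m, where the G_m
    satisfy the same hypotheses with a smaller bound. *)
Lemma tower_const (N : nat) (F : nat -> {poly A}) :
    (forall m, size (F m) <= m.+1)%N -> (forall m, tower_eq F m) ->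
    (forall m, (N <= m)%N -> F m = 0) ->
  exists k : nat -> K, forall m,
    F m.*2 = tricst (k m) * (1 + 'X^2) ^+ m /\ F m.*2.+1 = 0.
Proof.
have [n] := ubnP N; elim: n N F => // n IHn [|N] F ltN sF eF F0.
  by exists (fun=> 0) => m; rewrite !F0 // /tricst /bicst !polyC0 mul0r.
have i2 : 'i * 'i = - 1 :> K by rewrite -expr2 sqrCi.
have dM (p q : A) : (p * q)^`() = p^`() * q + p * q^`() by rewrite derivM.
have dc (k : K) : (bicst k)^`() = 0 by rewrite derivC.
have d'c (k : K) : derivin (bicst k) = 0 by rewrite derivinC derivC.
have cst_inj (k : K) : (bicst k == 0) = (k == 0) by rewrite /bicst !polyC_eq0.
have F0c : F 0 = ((F 0)`_0)%:P by apply: size1_polyC; apply: sF.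
(* At 'X = - i only the derivative in y survives in [transport], and 2 df_m/dy + i (m + 1) b f_(m+1)
   = 0. At 'X = i only the derivative in y' survives, and the sign of the second term is
   reversed. *)
pose lam k : K := - ('i * k.+1%:R / 2).
have lamE k : 2 * bicst (lam k) = - (bicst 'i * k.+1%:R) :> A.
  have cn l : l%:R = bicst l%:R :> A by rewrite /bicst !polyC_natr.
  by rewrite !cn -!bicstM -bicstN; congr bicst; rewrite /lam; field.
have two0 : 2 != 0 :> A by rewrite -polyC_natr polyC_eq0 -polyC_natr polyC_eq0 pnatr_eq0.
have ci2 : bicst 'i * bicst 'i = - 1 :> A by rewrite -bicstM i2 bicstN /bicst !polyC1.
have hd (p : {poly A}) k : (map_poly (@deriv {poly K}) p).[bicst k] = p.[bicst k]^`().
  by apply: horner_map_derivation => [x y|]; [apply: dM|apply: dc].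
have hd' (p : {poly A}) k : (map_poly (@derivin K) p).[bicst k] = derivin p.[bicst k].
  by apply: horner_map_derivation => [x y|]; [apply: derivinM|apply: d'c].
have em m : (F m).[bicst (- 'i)]^`() = bicst (lam m) * (b * (F m.+1).[bicst (- 'i)]).
  have := congr1 (fun p : {poly A} => p.[bicst (- 'i)]) (eF m).
  rewrite /= horner_transport hd hd' horner0 => E.
  apply: (mulfI two0); rewrite (mulrA 2) lamE; apply/subr0_eq.
  move: E; rewrite !bicstN; move: (_^`()) (derivin _) (_^`().[_]) ((F m.+1).[_]) => x z u v.
  move: (bicst 'i) ci2 => t t2 E.
  (* The two sides agree only modulo i^2 = - 1: they differ by a multiple of [t * t + 1]. *)
  match goal with |- ?G = _ => match type of E with ?L = _ =>
    have -> : G = L + (t * t + 1) * (x - z - b * u) by ring end end.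
  by rewrite E t2 addNr mul0r addr0.
have ep m : derivin (F m).[bicst 'i] = - bicst (lam m) * (b * (F m.+1).[bicst 'i]).
  have := congr1 (fun p : {poly A} => p.[bicst 'i]) (eF m).
  rewrite /= horner_transport hd hd' horner0 => E.
  apply: (mulfI two0); rewrite (mulrA 2) mulrN lamE opprK; apply/subr0_eq.
  move: E; move: (_^`()) (derivin _) (_^`().[_]) ((F m.+1).[_]) => x z u v.
  move: (bicst 'i) ci2 => t t2 E.
  match goal with |- ?G = _ => match type of E with ?L = _ =>
    have -> : G = L + (t * t + 1) * (z - x - b * u) by ring end end.
  by rewrite E t2 addNr mul0r addr0.
(* This is the sum of the coefficients of 1 and 'X^2 in the degree 2 equation, in which the terms in
   [b] cancel. *)
have e1 : (F 1).[bicst 'i]^`() + derivin (F 1).[bicst (- 'i)] = 0.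
  have F1 : F 1 = ((F 1)`_0)%:P + (F 1)`_1 *: 'X.
    apply/polyP => i; rewrite coefD coefC coefZ coefX.
    case: i => [|[|i]]; rewrite /= ?mulr0 ?addr0 ?mulr1 ?add0r //.
    by rewrite nth_default // (leq_trans (sF 1)).
  have z3 : (F 2)`_3 = 0 by rewrite nth_default ?sF.
  have z2 : (F 1)`_2 = 0 by rewrite nth_default ?sF.
  have E i := congr1 (fun p : {poly A} => p`_i) (eF 1).
  have := E 0; have := E 2 => {E}.
  rewrite /= coef2_transport coef0_transport !coef0 !coef_map /= z3 z2 !raddf0 => E2 E0.
  rewrite F1 !(hornerD, hornerZ, hornerX, hornerC) derivD derivinD derivM derivinM dc d'c
    bicstN.
  match type of E0 with ?L0 = _ => match type of E2 with ?L2 = _ =>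
    match goal with |- ?G = _ => have -> : G = L0 + L2 end end end.
    ring.
  by rewrite E0 E2 addr0.
have lam0 k : lam k != 0.
  by rewrite oppr_eq0 !mulf_neq0 ?invr_eq0 ?pnatr_eq0 // neq0Ci.
have FN m : (N < m)%N -> (F m).[bicst (- 'i)] = 0 by move=> /F0->; rewrite horner0.
(* F_0 is constant in 'X, so its values at i and - i coincide. *)
have eg : derivin (F 0).[bicst (- 'i)] = - bicst (lam 0) * (b * (F 1).[bicst 'i]).
  by rewrite -ep F0c !hornerC.
have [[k0 fk0] fz] := chain_const c_neq0 c'_neq0 lam0 em FN eg e1.
have F0k : F 0 = tricst k0 by rewrite /tricst -fk0 [in RHS]F0c hornerC -F0c.
have b0 : b != 0.
  apply/eqP => /(congr1 (fun q : A => q`_2)) /eqP.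
  by rewrite coefD coefCM coefXn coefC /= mulr1 addr0 coef0 polyC_eq0 (negPf c_neq0).
have gz m : (F m.+1).[bicst 'i] = 0.
  elim: m => [|m IHm]; [have := ep 0; rewrite F0k hornerC d'c|have := ep m.+1; rewrite IHm
    raddf0];
  by move=> /esym/eqP; rewrite mulNr oppr_eq0 !mulf_eq0 (negPf b0) cst_inj (negPf (lam0 _))
    => /eqP.
have w0 : 1 + 'X^2 != 0 :> {poly A}.
  by rewrite -size_poly_eq0 addrC -[1]polyC1 size_XnaddC.
have exG m : exists q : {poly A}, (F m.+1 == (1 + 'X^2) * q) && (size q <= size (F m.+1) - 2)%N.
  have [q Fq sq] := divide_1X2 (gz m) (fz m); exists q.
  by rewrite sq Fq eqxx.
pose G m := xchoose (exG m.+1).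
have GF m : F m.+2 = (1 + 'X^2) * G m by have /andP[/eqP] := xchooseP (exG m.+1).
(* F_1 has degree at most 1 in 'X and is divisible by [1 + 'X^2]. *)
have F1 : F 1 = 0.
  have [q /andP[/eqP F1q sq]] := exG 0; rewrite F1q; suff -> : q = 0 by rewrite mulr0.
  apply/eqP; rewrite -size_poly_leq0 (leq_trans sq) //.
  exact: (leq_sub2r 2 (sF 1)).
have [||||k kG] := IHn N G.
- by [].
- move=> m; have /andP[_ sG] := xchooseP (exG m.+1).
  by rewrite (leq_trans sG) //; apply: leq_trans (leq_sub2r 2 (sF m.+2)) _; rewrite subn2.
- move=> m; have := eF m.+2; rewrite /tower_eq !GF.
  rewrite (map_derivation_1X2 _ dM) (map_derivation_1X2 _ (@derivinM K)).
  have -> : m.+3%:R = m.+1%:R + 2 :> A by rewrite -natrD addn2.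
  by rewrite transportM => /eqP; rewrite mulf_eq0 (negPf w0) => /eqP.
- move=> m leNm; have /eqP := F0 m.+2 (leqW leNm).
  by rewrite GF mulf_eq0 (negPf w0) => /eqP.
exists (fun m => if m is m'.+1 then k m' else k0) => -[|m].
  by rewrite F0k F1 expr0 mulr1.
have [kG1 kG2] := kG m; rewrite doubleS !GF kG1 kG2 mulr0 [_ ^+ m.+1]exprS; split=> //.
by rewrite mulrCA.
Qed.

End Tower.

End TowerOfPolynomials.

(** The chain rule for the substitution of [u], when [D] acts on the coefficients as [a * E]. *)
Lemma derivation_horner_morph (R B : comNzRingType) (f : {rmorphism R -> B}) (u a : B)
    (cfu : commr_rmorph f u) (D : {additive B -> B}) (E : {additive R -> R}) (P : {poly R}) :
    (forall x y, D (x * y) = D x * y + x * D y) -> (forall r, D (f r) = a * f (E r)) ->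
  D (horner_morph cfu P) =
  a * horner_morph cfu (map_poly E P) + D u * horner_morph cfu P^`().
Proof.
move=> DM Df; elim/poly_ind: P => [|P r IHP].
  by rewrite deriv0 !raddf0 !mulr0 addr0.
rewrite derivMXaddC !rmorphD !rmorphM /= horner_morphX horner_morphC !raddfD /= DM IHP Df.
have -> : map_poly E (P * 'X) = map_poly E P * 'X.
  by apply/polyP => -[|i]; rewrite ?coef_map !coefMX ?coef_map //= raddf0.
rewrite map_polyC rmorphM /= horner_morphX horner_morphC; ring.
Qed.

(** * From real to isotropic coordinates *)

Section Isotropic.
Variables (R : numFieldType) (K : numClosedFieldType) (phi : {rmorphism R -> K}).
Variables (a1 a2 : R).
Local Notation A := {poly {poly K}}.
Local Notation cstK := (@bicst K).

Definition bicst_mor : {rmorphism R -> A} := ((polyC \o polyC) \o phi).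

(* The real coordinates [x_1] and [x_2] in terms of [y = (x_1 - a1) + i (x_2 - a2)]
   and [y']. In [{poly {poly R}}] the outer variable is [x_2] and the inner one [x_1]. *)
Definition xi1 : A := cstK 2^-1 * ('X + ('X)%:P) + cstK (phi a1).
Definition xi2 : A := cstK (- 'i / 2) * ('X - ('X)%:P) + cstK (phi a2).

Definition iso_subst1 : {rmorphism {poly R} -> A} := horner_morph (fun r => mulrC xi1
  (bicst_mor r)).
Definition iso_subst : {rmorphism {poly {poly R}} -> A} :=
  horner_morph (fun p => mulrC xi2 (iso_subst1 p)).

Lemma iso_substC (r : R) : iso_subst r%:P%:P = cstK (phi r).
Proof. by rewrite /iso_subst /= horner_morphC /= horner_morphC. Qed.

Lemma iso_substX : iso_subst 'X = xi2.
Proof. exact: horner_morphX. Qed.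

Lemma iso_substY : iso_subst ('X)%:P = xi1.
Proof. by rewrite /iso_subst /= horner_morphC /= horner_morphX. Qed.

Lemma derivation_iso_subst (D : {additive A -> A}) (P : {poly {poly R}}) :
    (forall x y, D (x * y) = D x * y + x * D y) -> (forall k, D (cstK k) = 0) ->
  D (iso_subst P) = D xi1 * iso_subst (map_poly (@deriv R) P) + D xi2 * iso_subst P^`().
Proof.
move=> DM Dc; apply: derivation_horner_morph => // p.
(* [D] vanishes on scalars, so [a = 0] and any [E] will do. *)
have -> := derivation_horner_morph (a := 0) (E := idfun) _ p DM.
  by rewrite mul0r add0r.
by move=> r; rewrite mul0r; apply: Dc.
Qed.

Lemma deriv_iso_subst (P : {poly {poly R}}) :
  (iso_subst P)^`() = cstK 2^-1 * iso_subst (map_poly (@deriv R) P) + cstK (- 'i / 2) *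
    iso_subst P^`().
Proof.
have -> : cstK 2^-1 = xi1^`() by rewrite /xi1 /bicst !(derivD, derivN, derivM, derivX,
  derivC); ring.
have -> : cstK (- 'i / 2) = xi2^`() by rewrite /xi2 /bicst !(derivD, derivN, derivM,
  derivX, derivC); ring.
by apply: derivation_iso_subst => [x y|k]; rewrite /= ?derivM // /bicst derivC.
Qed.

Lemma derivin_iso_subst (P : {poly {poly R}}) :
  derivin (iso_subst P) = cstK 2^-1 * iso_subst (map_poly (@deriv R) P) - cstK (- 'i / 2) *
    iso_subst P^`().
Proof.
have Dc (k : K) : derivin (cstK k) = 0 by rewrite derivinC derivC.
have -> : cstK 2^-1 = derivin xi1.
  by rewrite /xi1 derivinD derivinM derivinD derivinX derivinC derivX !Dc; ring.
have dxi2 : derivin xi2 = - cstK (- 'i / 2).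
  rewrite /xi2 derivinD derivinM !Dc mul0r add0r addr0 raddfB /= derivinX derivinC derivX sub0r.
  by rewrite polyC1 mulrN mulr1.
rewrite -[- (_ * iso_subst _)]mulNr -dxi2.
by apply: derivation_iso_subst => [x y|k]; [apply: derivinM|apply: Dc].
Qed.

(** Together with d/dx_2 = i (d/dy - d/dy') this turns d/dx_1 + 'X d/dx_2 into (1 + i 'X) d/dy + (1
    - i 'X) d/dy', the first two terms of [transport]. *)
Lemma iso_subst_dx (P : {poly {poly R}}) :
  (iso_subst P)^`() + derivin (iso_subst P) = iso_subst (map_poly (@deriv R) P).
Proof.
rewrite deriv_iso_subst derivin_iso_subst addrACA subrr addr0 -mulrDl -bicstD.
by rewrite (_ : 2^-1 + 2^-1 = 1 :> K) /bicst ?mul1r //; field.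
Qed.

Lemma iso_subst_dy (P : {poly {poly R}}) :
  cstK 'i * ((iso_subst P)^`() - derivin (iso_subst P)) = iso_subst P^`().
Proof.
have -> : (iso_subst P)^`() - derivin (iso_subst P) = cstK (- 'i / 2) * iso_subst P^`() *+ 2.
  by rewrite deriv_iso_subst derivin_iso_subst; ring.
rewrite mulr2n mulrDr !mulrA -!bicstM -mulrDl -bicstD.
rewrite (_ : _ + _ = 1 :> K); first by rewrite /bicst mul1r.
have -> : 'i * (- 'i / 2) + 'i * (- 'i / 2) = - ('i ^+ 2) :> K by field.
by rewrite sqrCi opprK.
Qed.

Definition isoz (s t : R) : K := phi (s - a1) + 'i * phi (t - a2).
Definition isozb (s t : R) : K := phi (s - a1) - 'i * phi (t - a2).

(** Evaluation at the image of a real point brings conclusions over [K] back to [R]. *)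
Lemma horner_iso_subst (P : {poly {poly R}}) (s t : R) :
  (iso_subst P).[(isoz s t)%:P].[isozb s t] = phi P.[t%:P].[s].
Proof.
have i2 : 'i * 'i = - 1 :> K by rewrite -expr2 sqrCi.
pose ev (p : A) := p.[(isoz s t)%:P].[isozb s t].
have evC k : ev (cstK k) = k by rewrite /ev /bicst !hornerC.
have evD p q : ev (p + q) = ev p + ev q by rewrite /ev !hornerD.
have evM p q : ev (p * q) = ev p * ev q by rewrite /ev !hornerM.
have ev1 : ev xi1 = phi s.
  by rewrite evD evM !evC evD /ev hornerX !hornerC hornerX /isoz /isozb !rmorphB; field.
have ev2 : ev xi2 = phi t.
  rewrite evD evM !evC /ev hornerD hornerN hornerX !hornerC hornerD hornerN hornerC hornerX.
  rewrite /isoz /isozb !rmorphB.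
  have -> : - 'i / 2 * (phi s - phi a1 + 'i * (phi t - phi a2) -
      (phi s - phi a1 - 'i * (phi t - phi a2))) = - ('i * 'i) * (phi t - phi a2) by field.
  by rewrite i2 opprK mul1r subrK.
have s1 p : ev (iso_subst1 p) = phi p.[s].
  elim/poly_ind: p => [|p r IHp]; first by rewrite raddf0 /ev !horner0 raddf0.
  rewrite rmorphD rmorphM /= horner_morphX horner_morphC evD evM IHp ev1 evC.
  by rewrite hornerMXaddC rmorphD rmorphM.
rewrite -/(ev _); elim/poly_ind: P => [|P r IHP].
  by rewrite raddf0 /ev !horner0 raddf0.
rewrite rmorphD rmorphM /= horner_morphX horner_morphC evD evM IHP ev2 s1.
by rewrite hornerMXaddC hornerD hornerM hornerC rmorphD rmorphM.
Qed.

End Isotropic.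

(** * From integrals in real coordinates to towers, and back *)

Definition lag (V : zmodType) (f : nat -> V) i := if i is k.+1 then f k else 0.

Lemma coef_transport (B : comNzRingType) (s b n : B) (P Q V : {poly B}) j :
  (transport s b n P Q V)`_j =
  P`_j + Q`_j + s * lag (fun k => P`_k - Q`_k) j
  + b * (V`_j.+1 *+ j.+1 - lag (fun k => (n - k%:R) * V`_k) j).
Proof.
rewrite /transport !mulrDl !mul1r mulNr -!mulrA !(coefD, coefN, coefCM, coefXM, coefXnM).
by case: j => [|[|j]] /=; rewrite ?subSS ?subn0 !coef_deriv /=; ring.
Qed.

Section Tower.
Variables (K : numClosedFieldType) (c c' e0 : K).
Local Notation A := {poly {poly K}}.
Local Notation cstK := (@bicst K).
Variables (Q : comNzRingType) (S : {rmorphism Q -> A}) (dx dy : Q -> Q) (Bp : Q).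
Hypothesis Sdx : forall P, (S P)^`() + derivin (S P) = S (dx P).
Hypothesis Sdy : forall P, cstK 'i * ((S P)^`() - derivin (S P)) = S (dy P).
Hypothesis SB : S Bp = quadric c c' e0.
Variable G : nat -> nat -> Q.

Definition tower m : {poly A} := \poly_(j < m.+1) S (G (m - j) j).

(** The hypothesis is the coefficient of v_1^i v_2^j in the integral equation for F = sum G_ij v_1^i
    v_2^j, [lag] being the index shift due to a factor v_1 or v_2. Coefficient [j] of [tower_eq] is
    the case i = m + 1 - j. *)
Lemma tower_transport m :
    (forall i j, lag (fun k => dx (G k j)) i + lag (fun k => dy (G i k)) j
      + Bp * (j.+1%:R * lag (fun k => G k j.+1) i - i.+1%:R * lag (fun k => G i.+1 k) j) = 0) ->
  tower_eq c c' e0 tower m.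
Proof.
move=> E; apply/polyP => j.
have cF n k : (tower n)`_k = if (k <= n)%N then S (G (n - k) k) else 0.
  by rewrite coef_poly ltnS.
rewrite coef_transport coef0 !coef_map !cF /= -SB.
have := congr1 S (E (m.+1 - j)%N j).
rewrite raddf0 !raddfD /= rmorphM raddfB /= !rmorphM /= !rmorph_nat.
case: j => [|k].
  by rewrite !subn0 /= subSS subn0 Sdx raddf0 !mulr0 !addr0 !subr0 mulr1n mul1r.
rewrite /= !coef_map !cF /= subSS.
(* Here j = k + 1 and the exponent of v_1 is m - k: positive, negative or zero. When it is negative
   all terms vanish, at k = m + 1 because of the factor m + 1 - k. *)
case: (ltngtP k m) => km.
- have -> : (m - k)%N = (m - k.+1).+1 by lia.
  have -> : (k <= m.+1)%N by lia.
  have -> : (m.+1 - k = (m - k.+1).+2)%N by lia.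
  rewrite ltnS km /= Sdx Sdy subSS.
  have -> : (m.+1%:R - k%:R : A) = (m - k.+1).+2%:R by rewrite -natrB; [congr _%:R; lia|lia].
  by rewrite [k.+2%:R * _]mulr_natl.
- move=> _; rewrite [(k.+1 < m.+1)%N]ltnS [(k < m)%N]ltnNge (ltnW km) /=.
  rewrite deriv0 (raddf0 (@derivin K)) subr0 !mulr0 !add0r mul0rn sub0r.
  case: (ltngtP k m.+1) => [lekm|_|->]; first by lia.
    by rewrite !mulr0 oppr0 mulr0.
  by rewrite subrr mul0r oppr0 mulr0.
- rewrite km ltnS ltnn subnn /= leqnSn subSn // subnn deriv0 !raddf0 !add0r Sdy mulr0 add0r.
  by rewrite mul0rn sub0r -natrB // subSnn.
Qed.

End Tower.

Lemma coef_1X2_exp (R : comNzRingType) m : (((1 + 'X^2) ^+ m : {poly R})`_0 = 1).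
Proof. by rewrite -horner_coef0 horner_exp hornerD hornerXn hornerC expr0n addr0 expr1n. Qed.

Section Conclusion.
Variables (R : numFieldType) (K : numClosedFieldType) (phi : {rmorphism R -> K}).
Variables q3 q4 q5 q6 q7 : R.

(** The magnetic field b at the momenta [q3], ..., [q7]; the inner variable is x_1, the outer one
    x_2. *)
Definition curl_poly : {poly {poly R}} :=
  q3%:P%:P + q4%:P%:P * ('X)%:P + q5%:P%:P * 'X
  + (q6 / 2)%:P%:P * (('X)%:P ^+ 2 - 'X ^+ 2) + q7%:P%:P * ('X)%:P * 'X.

Lemma horner_curl_poly s t : curl_poly.[t%:P].[s] =
  q3 + q4 * s + q5 * t + q6 / 2 * (s ^+ 2 - t ^+ 2) + q7 * s * t.
Proof. by rewrite /curl_poly !(hornerD, hornerN, hornerM, hornerC, hornerX, horner_exp). Qed.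

(** In isotropic coordinates centred at the critical point of the field, the field is
    [quadric c c' e0], and the condition on [q6] and [q7] says that [c] and [c'] are nonzero; so
    [tower_const] applies over [K]. *)
Lemma integral_coefs (d : nat) (G : nat -> nat -> {poly {poly R}}) :
    q6 ^+ 2 + q7 ^+ 2 != 0 ->
    (forall i j, (d < i + j)%N -> G i j = 0) ->
    (forall i j, lag (fun k => map_poly (@deriv R) (G k j)) i + lag (fun k => (G i k)^`()) j
      + curl_poly * (j.+1%:R * lag (fun k => G k j.+1) i
                      - i.+1%:R * lag (fun k => G i.+1 k) j) = 0) ->
  exists k : nat -> R, forall m j, (j <= m)%N ->
    G (m - j)%N j = ((if odd m then 0 else k m./2 *: (1 + 'X^2) ^+ m./2 : {poly R})`_j)%:P%:P.
Proof.
move=> q67 G0 E.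
have i2 : 'i * 'i = - 1 :> K by rewrite -expr2 sqrCi.
(* The critical point of the field solves q4 + q6 a1 + q7 a2 = 0 and q5 - q6 a2 + q7 a1 = 0. *)
pose a1 := - (q4 * q6 + q5 * q7) / (q6 ^+ 2 + q7 ^+ 2).
pose a2 := (q5 * q6 - q4 * q7) / (q6 ^+ 2 + q7 ^+ 2).
(* In centred coordinates the quadratic part q6 / 2 (x_1^2 - x_2^2) + q7 x_1 x_2 is c y^2 + c'
   y'^2. *)
pose c : K := (phi q6 - 'i * phi q7) / 4.
pose c' : K := (phi q6 + 'i * phi q7) / 4.
pose e0 : K := phi (curl_poly.[a2%:P].[a1]).
have cc : c * c' = phi (q6 ^+ 2 + q7 ^+ 2) / 16.
  have -> : c * c' = (phi q6 ^+ 2 - 'i * 'i * phi q7 ^+ 2) / 16 by rewrite /c /c'; field.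
  by rewrite i2 rmorphD !rmorphXn mulN1r opprK.
have : c * c' != 0 by rewrite cc mulf_neq0 ?fmorph_eq0 // invr_eq0 pnatr_eq0.
rewrite mulf_eq0 negb_or => /andP[c0 c'0].
have SB : iso_subst phi a1 a2 curl_poly = quadric c c' e0.
  have A0 : phi q4 + phi a1 * phi q6 + phi a2 * phi q7 = 0.
    rewrite -!rmorphM -!rmorphD /=; apply: (etrans (congr1 phi _) (rmorph0 phi)).
    by rewrite /a1 /a2; field.
  have A1 : phi q5 - phi a2 * phi q6 + phi a1 * phi q7 = 0.
    rewrite -!rmorphM -rmorphN -!rmorphD /=; apply: (etrans (congr1 phi _) (rmorph0 phi)).
    by rewrite /a1 /a2; field.
  apply: poly2_ext => Y W.
  pose ev (p : {poly {poly K}}) := p.[Y%:P].[W].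
  have evC r : ev (bicst r) = r by rewrite /ev /bicst !hornerC.
  have evD p q : ev (p + q) = ev p + ev q by rewrite /ev !hornerD.
  have evN p : ev (- p) = - ev p by rewrite /ev !hornerN.
  have evM p q : ev (p * q) = ev p * ev q by rewrite /ev !hornerM.
  have evX : ev 'X = Y by rewrite /ev hornerX hornerC.
  have evY : ev ('X)%:P = W by rewrite /ev hornerC hornerX.
  have evP (p : {poly K}) : ev p%:P = p.[W] by rewrite /ev hornerC.
  rewrite -!/(ev _) /curl_poly !rmorphD !rmorphM rmorphB !rmorphXn /= !iso_substC
    !iso_substX !iso_substY.
  rewrite /quadric /e0 horner_curl_poly /xi1 /xi2 !expr2.
  rewrite !(evD, evM, evN, evC, evX, evP) !(hornerD, hornerZ, hornerM, hornerX, hornerC).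
  set V := - 'i / 2 * (Y - W); set U := 2^-1 * (Y + W).
  have VV : V * V = - ((Y - W) * (Y - W)) / 4.
    have -> : V * V = 'i * 'i * ((Y - W) * (Y - W)) / 4 by rewrite /V; field.
    by rewrite i2 mulN1r.
  have p62 : phi (q6 / 2) = phi q6 / 2 by rewrite fmorph_div rmorph_nat.
  have -> : phi (q3 + q4 * a1 + q5 * a2 + q6 / 2 * (a1 * a1 - a2 * a2) + q7 * a1 * a2) =
      phi q3 + phi q4 * phi a1 + phi q5 * phi a2
      + phi q6 / 2 * (phi a1 * phi a1 - phi a2 * phi a2) + phi q7 * phi a1 * phi a2.
    by rewrite -p62 -!rmorphM -rmorphB -!rmorphM -!rmorphD.
  rewrite fmorphV rmorph_nat.
  apply/subr0_eq.
  match goal with |- ?L = _ => have -> : L = (phi q4 + phi a1 * phi q6 + phi a2 * phi q7) * U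
    + (phi q5 - phi a2 * phi q6 + phi a1 * phi q7) * V
    - phi q6 / 2 * (V * V + (Y - W) * (Y - W) / 4) end.
    by rewrite /c /c' /U /V; field.
  by rewrite A0 A1 VV mulNr addNr !mul0r !mulr0 subr0 addr0.
have [|||k Fk] := @tower_const K c c' e0 c0 c'0 d.+1 (tower (iso_subst phi a1 a2) G).
- by move=> m; apply: size_poly.
- move=> m; apply: tower_transport SB _ _ E => P; [exact: iso_subst_dx|exact: iso_subst_dy].
- move=> m ltdm; apply/polyP => j; rewrite coef_poly coef0; case: ltnP => // lejm.
  by rewrite G0 ?raddf0 //; lia.
(* A polynomial that becomes constant after the substitution takes a single value at all real
   points, as [phi] is injective. *)
have sig_const P kap : iso_subst phi a1 a2 P = bicst kap -> P = (P.[0%:P].[0])%:P%:P /\ phi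
  P.[0%:P].[0] = kap.
  move=> SP; have ev s t : phi P.[t%:P].[s] = kap.
    by rewrite -(horner_iso_subst phi a1 a2) SP /bicst !hornerC.
  split=> //; apply: poly2_ext => t s; apply: (fmorph_inj phi).
  by rewrite !hornerC !ev.
have wE m j : ((1 + 'X^2) ^+ m : {poly {poly {poly K}}})`_j =
    bicst (phi ((1 + 'X^2) ^+ m : {poly R})`_j).
  have <- : map_poly (bicst_mor phi) ((1 + 'X^2) ^+ m) = (1 + 'X^2) ^+ m.
    by rewrite rmorphXn rmorphD rmorph1 /= map_polyXn.
  by rewrite coef_map.
have cE n j : (j <= n)%N -> iso_subst phi a1 a2 (G (n - j)%N j) = (tower (iso_subst phi a1
  a2) G n)`_j.
  by move=> lejn; rewrite coef_poly ltnS lejn.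
(* The constant term of (1 + 'X^2)^m is 1, so the scalar [k m] of [K] is the image of the constant
   [G m.*2 0], which lies in [R]. *)
exists (fun m => (G m.*2 0).[0%:P].[0]) => n j lejn.
rewrite -[n]odd_double_half in lejn *; move: (odd n) n./2 lejn => [] m lejn.
  have [_ Fm] := Fk m; rewrite oddD /= odd_double /= coef0.
  have [|PE P0] := sig_const (G (1 + m.*2 - j)%N j) 0.
    by rewrite cE // Fm coef0 /bicst !polyC0.
  by rewrite PE; congr (_%:P%:P); apply: (fmorph_inj phi); rewrite P0 rmorph0.
have [Fm _] := Fk m; rewrite !add0n odd_double doubleK in lejn *.
have sm l : (l <= m.*2)%N -> iso_subst phi a1 a2 (G (m.*2 - l)%N l) =
    bicst (k m * phi ((1 + 'X^2) ^+ m : {poly R})`_l).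
  by move=> lel; rewrite cE // Fm /tricst coefCM wE -bicstM.
have [_] := sig_const _ _ (sm 0 isT); rewrite subn0 coef_1X2_exp rmorph1 mulr1 => km.
have [PE P0] := sig_const _ _ (sm j lejn).
rewrite PE; congr (_%:P%:P); apply: (fmorph_inj phi).
by rewrite P0 coefZ rmorphM km.
Qed.

End Conclusion.

(** * Sums over homogeneous components, and polynomial functions *)

Lemma sum_antidiagonals (V : nmodType) (N : nat) (b : nat -> nat -> V) :
    (forall i j, (N <= i + j)%N -> b i j = 0) ->
  \sum_(j < N) \sum_(i < N) b i j = \sum_(n < N) \sum_(j < n.+1) b (n - j)%N j.
Proof.
move=> b0; under [RHS]eq_bigr => n _ do
  rewrite (big_ord_widen N (fun j => b (n - j)%N j)) ?ltn_ord //.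
rewrite [RHS](exchange_big_dep predT) //=; apply: eq_bigr => j _.
rewrite -(big_mkord xpredT (b^~ j)) (big_cat_nat _ (n := N - j)) ?leq_subr //=.
have -> : \sum_(N - j <= i < N) b i j = 0.
  by apply: big1_seq => i; rewrite mem_index_iota => lei; rewrite b0 //; lia.
rewrite addr0.
under [RHS]eq_bigl => i do rewrite ltnS.
transitivity (\sum_(0 + j <= n < N) b (n - j)%N j); last by rewrite add0n big_geq_mkord.
by rewrite big_addn; apply: eq_bigr => i _; rewrite addnK.
Qed.

(** Undoes the dehomogenization v = (1, 'X). *)
Lemma homogenize_1X2 (R : comNzRingType) (m : nat) (x y : R) :
  \sum_(j < m.*2.+1) ((1 + 'X^2) ^+ m : {poly R})`_j * x ^+ (m.*2 - j) * y ^+ j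
  = (x ^+ 2 + y ^+ 2) ^+ m.
Proof.
rewrite [in RHS]exprDn [in LHS]exprDn.
under eq_bigr => j _ do rewrite coef_sum !mulr_suml.
rewrite exchange_big; apply: eq_bigr => i _.
have lti : (i.*2 < m.*2.+1)%N by rewrite ltnS leq_double -ltnS.
rewrite (bigD1 (Ordinal lti)) //= big1 ?addr0 => [|j].
  rewrite expr1n mul1r -exprM coefMn coefXn mul2n eqxx -doubleB -!exprM !mul2n.
  by rewrite -mulrA mulr_natl.
rewrite -val_eqE /= => ne; rewrite expr1n mul1r -exprM coefMn coefXn mul2n (negPf ne).
by rewrite mul0rn !mul0r.
Qed.

Definition is_poly (R : nzRingType) (f : R -> R) := exists p : {poly R}, forall u, f u = p.[u].

Lemma is_polyC (R : nzRingType) (c : R) : is_poly (fun _ : R => c).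
Proof. by exists c%:P => u; rewrite hornerC. Qed.

Lemma is_polyD (R : nzRingType) (f g : R -> R) :
  is_poly f -> is_poly g -> is_poly (fun u => f u + g u).
Proof. by move=> [p fp] [q gq]; exists (p + q) => u; rewrite hornerD fp gq. Qed.

Lemma is_polyN (R : nzRingType) (f : R -> R) : is_poly f -> is_poly (fun u => - f u).
Proof. by move=> [p fp]; exists (- p) => u; rewrite hornerN fp. Qed.

Lemma is_polyM (R : comNzRingType) (f g : R -> R) :
  is_poly f -> is_poly g -> is_poly (fun u => f u * g u).
Proof. by move=> [p fp] [q gq]; exists (p * q) => u; rewrite hornerM fp gq. Qed.

Lemma is_polyX (R : comNzRingType) (f : R -> R) n : is_poly f -> is_poly (fun u => f u ^+ n).
Proof. by move=> [p fp]; exists (p ^+ n) => u; rewrite horner_exp fp. Qed.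

Lemma is_poly_sum (R : nzRingType) (I : finType) (P : pred I) (f : I -> R -> R) :
  (forall i, is_poly (f i)) -> is_poly (fun u => \sum_(i | P i) f i u).
Proof.
move=> fp; have [p pE] := fin_all_exists fp; exists (\sum_(i | P i) p i) => u.
by rewrite horner_sum; apply: eq_bigr.
Qed.

Lemma is_poly_prod (R : comNzRingType) (I : finType) (P : pred I) (f : I -> R -> R) :
  (forall i, is_poly (f i)) -> is_poly (fun u => \prod_(i | P i) f i u).
Proof.
move=> fp; have [p pE] := fin_all_exists fp; exists (\prod_(i | P i) p i) => u.
by rewrite horner_prod; apply: eq_bigr.
Qed.

Lemma is_poly_eq0 (R : numDomainType) (f : R -> R) :
  is_poly f -> (forall u, u != 0 -> f u = 0) -> forall u, f u = 0.
Proof.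
move=> [p fp] f0 u; suff p0 : p = 0 by rewrite fp p0 horner0.
have /eqP : p * 'X = 0.
  apply: poly_ext => x; rewrite hornerMX horner0 -fp.
  by have [->|/f0->] := eqVneq x 0; rewrite ?mulr0 ?mul0r.
by rewrite mulf_eq0 polyX_eq0 orbF => /eqP.
Qed.

(** * Polynomiality of the coefficients *)

Section PolynomialInOneVariable.
Variable R : realType.
Implicit Types (h dh : R -> R -> R).

(* The bound on the degree in the first variable is uniform in the second one. *)
Definition polyx h := exists N, forall t,
  exists2 p : {poly R}, (size p <= N.+1)%N & forall s, h s t = p.[s].

Let node (k : nat) : R := k%:R.
Let node_inj : injective node.
Proof. by move=> m n /eqP; rewrite /node eqr_nat => /eqP. Qed.

(** The uniform degree bound allows the same nodes for all [t], so that [t] enters only through the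
    values of [h] at finitely many first arguments. *)
Lemma polyx_lagrange h : polyx h ->
  exists n (L : 'I_n -> {poly R}), forall s t, h s t = \sum_(l < n) h (node l) t * (L l).[s].
Proof.
move=> [N hN]; exists N.+1, (fun l => tnth (lagrange N.+1 node) l : {poly R}) => s t.
have [p sp hp] := hN t; rewrite hp {1}(lagrange_gen (ltn0Sn N) node_inj sp).
rewrite horner_sum; apply: eq_bigr => l _.
by rewrite hornerM hornerC hp.
Qed.

(** Differentiating the interpolation formula in [t] leaves the polynomials in [s] unchanged. *)
Lemma polyx_derivey h dh : polyx h -> (forall s t : R, is_derive t (1 : R) (h s) (dh s t)) ->
  polyx dh.
Proof.
move=> /polyx_lagrange[n [L hL]] hdh; exists (\max_(l < n) size (L l)) => t.
exists (\sum_(l < n) dh (node l) t *: L l).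
  apply: leq_trans (size_sum _ _ _) _; apply/bigmax_leqP => l _.
  by rewrite (leq_trans (size_scale_leq _ _)) // leqW // leq_bigmax.
move=> s; rewrite horner_sum.
have -> : \sum_(l < n) (dh (node l) t *: L l).[s] = \sum_(l < n) (L l).[s] *: dh (node l) t.
  by apply: eq_bigr => l _; rewrite hornerZ mulrC.
have D : is_derive t (1 : R) (\sum_(l < n) (fun t => (L l).[s] *: h (node l) t)) (\sum_(l <
  n) (L l).[s] *: dh (node l) t).
  by apply: is_derive_sum => l; apply: is_deriveZ.
rewrite -(@derive_val _ _ _ _ _ _ _ D) -(@derive_val _ _ _ _ _ _ _ (hdh s t)).
congr ('D_1 _ t); apply/funext => u; rewrite hL fct_sumE.
by apply: eq_bigr => l _; rewrite mulrC.
Qed.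

Lemma polyx_primitive h dh : polyx dh ->
  (forall s t : R, is_derive s (1 : R) (h ^~ t) (dh s t)) -> polyx h.
Proof.
move=> [N dhN] hdh; exists N.+1 => t; have [p sp hp] := dhN t.
have D s : is_derive s (1 : R) (fun s => h s t - (antideriv p).[s]) 0.
  have -> : 0 = dh s t - (antideriv p)^`().[s] by rewrite antiderivK hp subrr.
  exact: is_deriveB.
exists (antideriv p + (h 0 t - (antideriv p).[0])%:P).
  apply: leq_trans (size_polyD _ _) _; rewrite geq_max.
  rewrite (leq_trans (size_poly _ _)) ?ltnS //.
  by rewrite (leq_trans (size_polyC_leq1 _)).
move=> s; rewrite hornerD hornerC.
by rewrite -(is_derive_0_is_cst s 0 D) addrC subrK.
Qed.

Lemma polyxC (c : R) : polyx (fun _ _ => c).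
Proof. by exists 0 => t; exists c%:P => [|s]; rewrite ?size_polyC_leq1 ?hornerC. Qed.

Lemma polyxD h dh : polyx h -> polyx dh -> polyx (fun s t => h s t + dh s t).
Proof.
move=> [N hN] [M hM]; exists (maxn N M) => t.
have [p sp hp] := hN t; have [q sq hq] := hM t; exists (p + q) => [|s]; last first.
  by rewrite hornerD hp hq.
by apply: leq_trans (size_polyD _ _) _; rewrite geq_max; lia.
Qed.

Lemma polyxM h dh : polyx h -> polyx dh -> polyx (fun s t => h s t * dh s t).
Proof.
move=> [N hN] [M hM]; exists (N + M)%N => t.
have [p sp hp] := hN t; have [q sq hq] := hM t; exists (p * q) => [|s]; last first.
  by rewrite hornerM hp hq.
by apply: leq_trans (size_polyMleq _ _) _; lia.
Qed.

Lemma polyxN h : polyx h -> polyx (fun s t => - h s t).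
Proof.
move=> /(polyxM (polyxC (- 1))); rewrite (_ : (fun _ _ => _) = (fun s t => - h s t)) //.
by apply/funext => s; apply/funext => t; rewrite mulN1r.
Qed.

(** By descending induction on i + j, then induction on j: the equation at (i + 1, j) expresses
    dg_ij/ds by dg_(i+1,j-1)/dt, of the same degree, and by coefficients of higher degree. [polyx]
    is stable under differentiation in [t] and integration in [s]. *)
Lemma transport_polyx (d : nat) (b : R -> R -> R) (g d1 d2 : nat -> nat -> R -> R -> R) :
    polyx b ->
    (forall i j (s t : R), is_derive s (1 : R) (g i j ^~ t) (d1 i j s t)) ->
    (forall i j (s t : R), is_derive t (1 : R) (g i j s) (d2 i j s t)) ->
    (forall i j s t, (d < i + j)%N -> g i j s t = 0) ->
    (forall i j s t,
      lag (fun k => d1 k j s t) i + lag (fun k => d2 i k s t) j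
      + b s t * (j.+1%:R * lag (fun k => g k j.+1 s t) i
                 - i.+1%:R * lag (fun k => g i.+1 k s t) j) = 0) ->
  forall i j, polyx (g i j).
Proof.
move=> pb g1 g2 g0 E.
suff S n : forall i j, (d < i + j + n)%N -> polyx (g i j).
  by move=> i j; apply: (S d.+1); lia.
elim: n => [|n IHn].
  move=> i j; rewrite addn0 => ltd.
  rewrite (_ : g i j = fun _ _ => 0); first exact: polyxC.
  by apply/funext => s; apply/funext => t; rewrite g0.
move=> i j; elim: j i => [|j IHj] i ltd; apply: polyx_primitive (g1 i _).
  rewrite (_ : d1 i 0 = fun s t => - (b s t * g i 1 s t)).
    by apply/polyxN/polyxM => //; apply: IHn; lia.
  apply/funext => s; apply/funext => t; apply/eqP; rewrite -addr_eq0.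
  by have := E i.+1 0 s t; rewrite /= addr0 mulr0 subr0 mul1r => ->.
rewrite (_ : d1 i j.+1 = fun s t => - (d2 i.+1 j s t + b s t *
    (j.+2%:R * g i j.+2 s t + - (i.+2%:R * g i.+2 j s t)))).
  apply/polyxN/polyxD; first by apply: polyx_derivey (g2 _ _); apply: IHj; lia.
  apply: polyxM => //; apply: polyxD; last apply: polyxN.
    by apply: polyxM; [apply: polyxC|apply: IHn; lia].
  by apply: polyxM; [apply: polyxC|apply: IHn; lia].
apply/funext => s; apply/funext => t; apply/eqP; rewrite -addr_eq0.
by have := E i.+1 j.+1 s t; rewrite /= addrA => ->.
Qed.

(** In the interpolation formula in [s], the values at the nodes are polynomials in [t]. *)
Lemma polyx_polyy_poly h : polyx h -> polyx (fun t s => h s t) ->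
  exists P : {poly {poly R}}, forall s t, h s t = P.[t%:P].[s].
Proof.
move=> /polyx_lagrange[n [L hL]] [M hM].
have /choice[p hp] : forall l : 'I_n, exists p : {poly R}, forall t, h (node l) t = p.[t].
  by move=> l; have [p _ hp] := hM (node l); exists p.
exists (\sum_(l < n) map_poly polyC (p l) * (L l)%:P) => s t.
rewrite hL !horner_sum; apply: eq_bigr => l _.
by rewrite !hornerM hornerC horner_map hornerC hp.
Qed.

Lemma derive_poly2x (P : {poly {poly R}}) (s t : R) :
  is_derive s (1 : R) (fun s => P.[t%:P].[s]) ((map_poly (@deriv R) P).[t%:P].[s]).
Proof.
rewrite (_ : (map_poly _ P).[_] = (P.[t%:P])^`()); first exact: is_derive_poly.
apply: horner_map_derivation => [p q|]; first by rewrite /= derivM.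
by rewrite /= derivC.
Qed.

Lemma derive_poly2y (P : {poly {poly R}}) (s t : R) :
  is_derive t (1 : R) (fun t => P.[t%:P].[s]) (P^`().[t%:P].[s]).
Proof.
have ev (Q : {poly {poly R}}) u : Q.[u%:P].[s] = (map_poly (horner_eval s) Q).[u].
  by have := horner_map (horner_eval s) Q u%:P; rewrite /= /horner_eval hornerC.
rewrite ev -deriv_map.
rewrite (_ : (fun _ => _) = horner (map_poly (horner_eval s) P)); first exact: is_derive_poly.
by apply/funext => u; rewrite ev.
Qed.

Lemma is_derive_unique (V : normedModType R) (f : V -> R) x v a a' :
  is_derive x v f a -> is_derive x v f a' -> a = a'.
Proof. by move=> D D'; rewrite -(@derive_val _ _ _ _ _ _ _ D) (@derive_val _ _ _ _ _ _ _
  D'). Qed.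

End PolynomialInOneVariable.

(** * The equations of motion in terms of the velocities *)

Section Slices.
Variables (R : realType) (V : normedModType R).
Implicit Types (f g : V -> R) (x v : V) (Z : R -> V).

Lemma is_derive_addf f g x v a b : is_derive x v f a -> is_derive x v g b ->
  is_derive x v (fun y => f y + g y) (a + b).
Proof. exact: is_deriveD. Qed.

Lemma is_derive_oppf f x v a : is_derive x v f a -> is_derive x v (fun y => - f y) (- a).
Proof. exact: is_deriveN. Qed.

Lemma is_derive_mulf f g x v a b : is_derive x v f a -> is_derive x v g b ->
  is_derive x v (fun y => f y * g y) (a * g x + f x * b).
Proof.
move=> Df Dg; have -> : a * g x + f x * b = f x *: b + g x *: a.
  by rewrite /GRing.scale /=; ring.
exact: is_deriveM.
Qed.

Lemma is_derive_expf f x v a n : is_derive x v f a ->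
  is_derive x v (fun y => f y ^+ n) (n%:R * f x ^+ n.-1 * a).
Proof.
move=> Df; have <- : f ^+ n = (fun y => f y ^+ n) by apply/funext => y; rewrite exprfctE.
exact: is_deriveX.
Qed.

Lemma is_derive_constf (c : R) x v : is_derive x v (fun _ => c) 0.
Proof. exact: is_derive_cst. Qed.

Lemma is_derive_bigf (I : finType) (P : pred I) (f : I -> V -> R) x v (a : I -> R) :
    (forall i, P i -> is_derive x v (f i) (a i)) ->
  is_derive x v (fun y => \sum_(i | P i) f i y) (\sum_(i | P i) a i).
Proof.
move=> Df; have -> : (fun y => \sum_(i | P i) f i y) = \sum_(i | P i) f i.
  by apply/funext => y; rewrite fct_sumE.
by elim/big_ind2 : _ => // [|] *; [exact: is_derive_cst|exact: is_deriveD].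
Qed.

(** [Z] runs along a line of direction [v], so the two difference quotients are the same
    function. *)
Lemma derive_slice f Z v s : (forall h, Z (h + s) = h *: v + Z s) ->
  'D_v f (Z s) = 'D_1 (f \o Z) s.
Proof.
move=> Zs; rewrite /derive.
suff -> : (fun h : R => h^-1 *: ((f \o shift (Z s)) (h *: v) - f (Z s))) =
  (fun h : R => h^-1 *: (((f \o Z) \o shift s) (h *: 1) - (f \o Z) s)) by [].
by apply/funext => h; rewrite /= /shift /= [_ *: 1]mulr1 Zs.
Qed.

Lemma derivable_slice f Z v s : (forall h, Z (h + s) = h *: v + Z s) ->
  derivable f (Z s) v -> derivable (f \o Z) s 1.
Proof.
move=> Zs; rewrite /derivable.
suff -> : (fun h : R => h^-1 *: ((f \o shift (Z s)) (h *: v) - f (Z s))) =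
  (fun h : R => h^-1 *: (((f \o Z) \o shift s) (h *: 1) - (f \o Z) s)) by [].
by apply/funext => h; rewrite /= /shift /= [_ *: 1]mulr1 Zs.
Qed.

End Slices.

Lemma is_derive_quadratic (R : realType) (f : R -> R) (c0 c1 c2 s a : R) :
    (forall y, f y = c0 + c1 * y + c2 * y ^+ 2) -> a = c1 + c2 * s *+ 2 ->
  is_derive s 1 f a.
Proof.
move=> fE ->; pose p := c0%:P + c1 *: 'X + c2 *: 'X^2.
have -> : f = horner p by apply/funext => y; rewrite fE /p !hornerE.
have -> : c1 + c2 * s *+ 2 = p^`().[s]
  by rewrite /p !derivD derivC !derivZ derivX derivXn /= expr1
    !(hornerD, hornerZ, hornerC, hornerMn, hornerX); ring.
exact: is_derive_poly.
Qed.

Section Phase.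
Variables (R : realType) (d : nat) (a : multi_index d -> 'rV[R]_2 -> R).
Variable q : 'I_7 -> R.
Hypothesis sm : forall tau, weight tau = d -> smooth (a tau).

(** p_3, ..., p_7 are read from [q], and x_3, ..., x_7 get the default value 0 of the list access;
    neither H nor F depends on the latter. *)
Definition phase_pt (s t p1 p2 : R) : 'rV[R]_(7 + 7) :=
  row_mx (\row_(i < 7) [:: s; t]`_i)
         (\row_(i < 7) (if i == 0 :> nat then p1 else if i == 1 :> nat then p2 else q i)).

Let o1 : 'I_7 := @Ordinal 7 1 isT.

Lemma phase_pt_s s t p1 p2 h :
  phase_pt (h + s) t p1 p2 = h *: delta_mx 0 (lshift 7 ord0) + phase_pt s t p1 p2.
Proof.
apply/rowP => k; rewrite !mxE; case: (split_ordP k) => j ->.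
  rewrite !mxE !(inj_eq (@lshift_inj _ _)) eqxx /=.
  by case: j => -[|[|j]] lej /=; rewrite ?mulr1 ?mulr0 ?add0r.
by rewrite !mxE eq_rlshift andbF mulr0 add0r.
Qed.

Lemma phase_pt_t s t p1 p2 h :
  phase_pt s (h + t) p1 p2 = h *: delta_mx 0 (lshift 7 o1) + phase_pt s t p1 p2.
Proof.
apply/rowP => k; rewrite !mxE; case: (split_ordP k) => j ->.
  rewrite !mxE !(inj_eq (@lshift_inj _ _)) eqxx /=.
  by case: j => -[|[|j]] lej /=; rewrite ?mulr1 ?mulr0 ?add0r.
by rewrite !mxE eq_rlshift andbF mulr0 add0r.
Qed.

Lemma phase_pt_p1 s t p1 p2 h :
  phase_pt s t (h + p1) p2 = h *: delta_mx 0 (rshift 7 ord0) + phase_pt s t p1 p2.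
Proof.
apply/rowP => k; rewrite !mxE; case: (split_ordP k) => j ->.
  by rewrite !mxE eq_lrshift andbF mulr0 add0r.
rewrite !mxE !(inj_eq (@rshift_inj _ _)) eqxx /=.
by case: j => -[|[|j]] lej /=; rewrite ?mulr1 ?mulr0 ?add0r.
Qed.

Lemma phase_pt_p2 s t p1 p2 h :
  phase_pt s t p1 (h + p2) = h *: delta_mx 0 (rshift 7 o1) + phase_pt s t p1 p2.
Proof.
apply/rowP => k; rewrite !mxE; case: (split_ordP k) => j ->.
  by rewrite !mxE eq_lrshift andbF mulr0 add0r.
rewrite !mxE !(inj_eq (@rshift_inj _ _)) eqxx /=.
by case: j => -[|[|j]] lej /=; rewrite ?mulr1 ?mulr0 ?add0r.
Qed.

Definition coef_at tau s t := a tau (\row_(j < 2) [:: s; t]`_j).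
Definition central_monomial (tau : multi_index d) := \prod_(i < 7 | (1 < i)%N) q i ^+ tau i.

Definition Fval s t p1 p2 := \sum_(tau : multi_index d | weight tau == d)
  coef_at tau s t * (p1 ^+ tau ord0 * p2 ^+ tau o1 * central_monomial tau).

(** Out of range, [inord] falls back to [ord0], whence the value [s]. *)
Lemma x_phase_pt s t p1 p2 k : x_ k.+1 (phase_pt s t p1 p2) = if (k < 7)%N then [:: s;
  t]`_k else s.
Proof.
rewrite /x_ /phase_pt row_mxEl mxE /=; case: ltnP => lek; first by rewrite inordK.
by rewrite /inord /insubd insubN // -leqNgt.
Qed.

Lemma p_phase_pt s t p1 p2 (i : 'I_7) : p_ i.+1 (phase_pt s t p1 p2) =
  if i == 0 :> nat then p1 else if i == 1 :> nat then p2 else q i.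
Proof. by rewrite /p_ /phase_pt row_mxEr mxE /= inord_val. Qed.

Lemma momentum_poly_phase_pt s t p1 p2 : momentum_poly a (phase_pt s t p1 p2) = Fval s t p1 p2.
Proof.
apply: eq_bigr => tau _; congr (a _ _ * _).
  by apply/rowP => j; rewrite !mxE x_phase_pt (leq_trans (ltn_ord j)).
rewrite (bigD1 ord0) // p_phase_pt (bigD1 o1) // p_phase_pt -mulrA; congr (_ * (_ * _)).
rewrite /central_monomial; apply: eq_big => [i|i]; last first.
  by rewrite p_phase_pt; case: i => -[|[|i]] lei.
by rewrite -!val_eqE /=; case: i => -[|[|i]] lei.
Qed.

Let q3 := q (inord 2).
Let q4 := q (inord 3).
Let q5 := q (inord 4).
Let q6 := q (inord 5).
Let q7 := q (inord 6).

(* [omega_1 = p_1 - pot1] and [omega_2 = p_2 - pot2]. *)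
Definition pot1 s t := 2^-1 * t * q3 + s * t * q4 + 2^-1 * s ^+ 2 * t * q6 + 4^-1 * s * t
  ^+ 2 * q7.
Definition pot2 s t := - (2^-1 * s * q3) - s * t * q5 + 2^-1 * s * t ^+ 2 * q6
  - 4^-1 * s ^+ 2 * t * q7.
Definition Hval s t p1 p2 := 2^-1 * ((p1 - pot1 s t) ^+ 2 + (p2 - pot2 s t) ^+ 2).

Lemma H2357_phase_pt s t p1 p2 : H2357 (phase_pt s t p1 p2) = Hval s t p1 p2.
Proof.
have p3 k : (k < 7)%N -> p_ k.+1 (phase_pt s t p1 p2) =
    if k == 0 then p1 else if k == 1 then p2 else q (inord k).
  by move=> ltk; have := p_phase_pt s t p1 p2 (Ordinal ltk); rewrite /= => ->;
    rewrite (_ : Ordinal ltk = inord k) //; apply/val_inj; rewrite /= inordK.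
by rewrite /H2357 !p3 // !x_phase_pt /= /Hval /pot1 /pot2; congr (_ * (_ ^+ 2 + _ ^+ 2));
  rewrite /q3 /q4 /q5 /q6 /q7; ring.
Qed.

Definition pot1_s s t := t * q4 + s * t * q6 + 4^-1 * t ^+ 2 * q7.
Definition pot1_t s t := 2^-1 * q3 + s * q4 + 2^-1 * s ^+ 2 * q6 + 2^-1 * s * t * q7.
Definition pot2_s s t := - (2^-1 * q3) - t * q5 + 2^-1 * t ^+ 2 * q6 - 2^-1 * s * t * q7.
Definition pot2_t s t := - (s * q5) + s * t * q6 - 4^-1 * s ^+ 2 * q7.

Lemma der_pot1_s s t : is_derive s (1 : R) (pot1 ^~ t) (pot1_s s t).
Proof.
by apply: (@is_derive_quadratic _ _ (2^-1 * t * q3) (t * q4 + 4^-1 * t ^+ 2 * q7)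
  (2^-1 * t * q6)) => [y|]; rewrite /pot1 /pot1_s; field.
Qed.

Lemma der_pot1_t s t : is_derive t (1 : R) (pot1 s) (pot1_t s t).
Proof.
by apply: (@is_derive_quadratic _ _ 0 (2^-1 * q3 + s * q4 + 2^-1 * s ^+ 2 * q6)
  (4^-1 * s * q7)) => [y|]; rewrite /pot1 /pot1_t; field.
Qed.

Lemma der_pot2_s s t : is_derive s (1 : R) (pot2 ^~ t) (pot2_s s t).
Proof.
by apply: (@is_derive_quadratic _ _ 0 (- (2^-1 * q3) - t * q5 + 2^-1 * t ^+ 2 * q6)
  (- (4^-1 * t * q7))) => [y|]; rewrite /pot2 /pot2_s; field.
Qed.

Lemma der_pot2_t s t : is_derive t (1 : R) (pot2 s) (pot2_t s t).
Proof.
by apply: (@is_derive_quadratic _ _ (- (2^-1 * s * q3)) (- (s * q5) - 4^-1 * s ^+ 2 * q7)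
  (2^-1 * s * q6)) => [y|]; rewrite /pot2 /pot2_t; field.
Qed.

Lemma der_sqsum (f g : R -> R) x b c : is_derive x (1 : R) f b -> is_derive x (1 : R) g c ->
  is_derive x (1 : R) (fun y => 2^-1 * (f y ^+ 2 + g y ^+ 2)) (f x * b + g x * c).
Proof.
move=> Df Dg; have D := is_derive_mulf (is_derive_constf (2^-1) x 1)
  (is_derive_addf (is_derive_expf 2 Df) (is_derive_expf 2 Dg)).
by apply: is_derive_eq D _ => /=; field.
Qed.

Lemma der_subf (f g : R -> R) x b c : is_derive x (1 : R) f b -> is_derive x (1 : R) g c ->
  is_derive x (1 : R) (fun y => f y - g y) (b - c).
Proof. by move=> Df Dg; apply: is_derive_addf Df (is_derive_oppf Dg). Qed.

Lemma der_Hval_s s t p1 p2 : is_derive s (1 : R) (fun s => Hval s t p1 p2)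
  ((p1 - pot1 s t) * - pot1_s s t + (p2 - pot2 s t) * - pot2_s s t).
Proof.
have D := der_sqsum (der_subf (is_derive_constf p1 s 1) (der_pot1_s s t))
  (der_subf (is_derive_constf p2 s 1) (der_pot2_s s t)).
by apply: is_derive_eq D _; rewrite !sub0r.
Qed.

Lemma der_Hval_t s t p1 p2 : is_derive t (1 : R) (fun t => Hval s t p1 p2)
  ((p1 - pot1 s t) * - pot1_t s t + (p2 - pot2 s t) * - pot2_t s t).
Proof.
have D := der_sqsum (der_subf (is_derive_constf p1 t 1) (der_pot1_t s t))
  (der_subf (is_derive_constf p2 t 1) (der_pot2_t s t)).
by apply: is_derive_eq D _; rewrite !sub0r.
Qed.

Lemma der_Hval_p1 s t p1 p2 : is_derive p1 (1 : R) (fun p1 => Hval s t p1 p2) (p1 - pot1 s t).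
Proof.
have D := der_sqsum (der_subf (is_derive_id p1 1) (is_derive_constf (pot1 s t) p1 1))
  (is_derive_constf (p2 - pot2 s t) p1 1).
by apply: is_derive_eq D _ => /=; ring.
Qed.

Lemma der_Hval_p2 s t p1 p2 : is_derive p2 (1 : R) (fun p2 => Hval s t p1 p2) (p2 - pot2 s t).
Proof.
have D := der_sqsum (is_derive_constf (p1 - pot1 s t) p2 1)
  (der_subf (is_derive_id p2 1) (is_derive_constf (pot2 s t) p2 1)).
by apply: is_derive_eq D _ => /=; ring.
Qed.

Definition coef_at_s tau s t : R := 'D_1 (coef_at tau ^~ t) s.
Definition coef_at_t tau s t : R := 'D_1 (coef_at tau s) t.

Lemma der_coef_at_s tau s t : weight tau == d -> is_derive s (1 : R) (coef_at tau ^~ t)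
  (coef_at_s tau s t).
Proof.
move=> /eqP/sm/(_ [::])[_ /(_ ord0 (\row_(j < 2) [:: s; t]`_j)) da].
apply: derivableP; apply: (@derivable_slice _ _ _ (fun s => \row_(j < 2) [:: s; t]`_j) _ _
  _ da).
move=> h; apply/rowP => j; rewrite !mxE eqxx /=.
by case: j => -[|[|j]] ltj //=; rewrite ?mulr1 ?mulr0 ?add0r.
Qed.

Lemma der_coef_at_t tau s t : weight tau == d -> is_derive t (1 : R) (coef_at tau s)
  (coef_at_t tau s t).
Proof.
move=> /eqP/sm/(_ [::])[_ /(_ ord_max (\row_(j < 2) [:: s; t]`_j)) da].
apply: derivableP; apply: (@derivable_slice _ _ _ (fun t => \row_(j < 2) [:: s; t]`_j) _ _
  _ da).
move=> h; apply/rowP => j; rewrite !mxE eqxx /=.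
by case: j => -[|[|j]] ltj //=; rewrite ?mulr1 ?mulr0 ?add0r.
Qed.

Definition Fval_s s t p1 p2 := \sum_(tau : multi_index d | weight tau == d)
  coef_at_s tau s t * (p1 ^+ tau ord0 * p2 ^+ tau o1 * central_monomial tau).
Definition Fval_t s t p1 p2 := \sum_(tau : multi_index d | weight tau == d)
  coef_at_t tau s t * (p1 ^+ tau ord0 * p2 ^+ tau o1 * central_monomial tau).
Definition Fval_p1 s t p1 p2 := \sum_(tau : multi_index d | weight tau == d)
  coef_at tau s t * ((tau ord0)%:R * p1 ^+ (tau ord0).-1 * p2 ^+ tau o1 * central_monomial tau).
Definition Fval_p2 s t p1 p2 := \sum_(tau : multi_index d | weight tau == d)
  coef_at tau s t * (p1 ^+ tau ord0 * ((tau o1)%:R * p2 ^+ (tau o1).-1) * central_monomial tau).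

Lemma der_Fval_s s t p1 p2 : is_derive s (1 : R) (fun s => Fval s t p1 p2) (Fval_s s t p1 p2).
Proof.
apply: is_derive_bigf => tau wt.
have D := is_derive_mulf (der_coef_at_s s t wt) (is_derive_constf (p1 ^+ tau ord0 * p2 ^+
  tau o1 * central_monomial tau) s 1).
by apply: is_derive_eq D _; rewrite mulr0 addr0.
Qed.

Lemma der_Fval_t s t p1 p2 : is_derive t (1 : R) (fun t => Fval s t p1 p2) (Fval_t s t p1 p2).
Proof.
apply: is_derive_bigf => tau wt.
have D := is_derive_mulf (der_coef_at_t s t wt) (is_derive_constf (p1 ^+ tau ord0 * p2 ^+
  tau o1 * central_monomial tau) t 1).
by apply: is_derive_eq D _; rewrite mulr0 addr0.
Qed.

Lemma der_Fval_p1 s t p1 p2 : is_derive p1 (1 : R) (fun p1 => Fval s t p1 p2) (Fval_p1 s t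
  p1 p2).
Proof.
apply: is_derive_bigf => tau wt.
have D := is_derive_mulf (is_derive_constf (coef_at tau s t) p1 1)
  (is_derive_mulf (is_derive_mulf (is_derive_expf (tau ord0) (is_derive_id p1 1))
     (is_derive_constf (p2 ^+ tau o1) p1 1)) (is_derive_constf (central_monomial tau) p1 1)).
by apply: is_derive_eq D _ => /=; ring.
Qed.

Lemma der_Fval_p2 s t p1 p2 : is_derive p2 (1 : R) (fun p2 => Fval s t p1 p2) (Fval_p2 s t
  p1 p2).
Proof.
apply: is_derive_bigf => tau wt.
have D := is_derive_mulf (is_derive_constf (coef_at tau s t) p2 1)
  (is_derive_mulf (is_derive_mulf (is_derive_constf (p1 ^+ tau ord0) p2 1)
     (is_derive_expf (tau o1) (is_derive_id p2 1))) (is_derive_constf (central_monomial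
       tau) p2 1)).
by apply: is_derive_eq D _ => /=; ring.
Qed.

(** Only the first two pairs of coordinates contribute, since the derivatives of H and F in x_3,
    ..., x_7 vanish. The factors [p1 - pot1 s t] and [p2 - pot2 s t] are the velocities. *)
Lemma poisson_phase_pt s t p1 p2 : poisson (@H2357 R) (momentum_poly a) (phase_pt s t p1 p2) =
  (p1 - pot1 s t) * Fval_s s t p1 p2 + (p2 - pot2 s t) * Fval_t s t p1 p2
  + ((p1 - pot1 s t) * pot1_s s t + (p2 - pot2 s t) * pot2_s s t) * Fval_p1 s t p1 p2
  + ((p1 - pot1 s t) * pot1_t s t + (p2 - pot2 s t) * pot2_t s t) * Fval_p2 s t p1 p2.
Proof.
have sl (f : 'rV[R]_(7 + 7) -> R) v (Z : R -> 'rV[R]_(7 + 7)) (g : R -> R) y dg :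
    (forall h, Z (h + y) = h *: v + Z y) -> (forall u, f (Z u) = g u) ->
    is_derive y (1 : R) g dg -> 'D_v f (Z y) = dg.
  move=> ZE fg D; rewrite (derive_slice f ZE) (_ : f \o Z = g); last exact/funext.
  exact: derive_val.
have pHs := sl _ _ _ _ _ _ (phase_pt_s s t p1 p2) (fun s => H2357_phase_pt s t p1 p2)
  (der_Hval_s s t p1 p2).
have pHt := sl _ _ _ _ _ _ (phase_pt_t s t p1 p2) (fun t => H2357_phase_pt s t p1 p2)
  (der_Hval_t s t p1 p2).
have pH1 := sl _ _ _ _ _ _ (phase_pt_p1 s t p1 p2) (fun p1 => H2357_phase_pt s t p1 p2)
  (der_Hval_p1 s t p1 p2).
have pH2 := sl _ _ _ _ _ _ (phase_pt_p2 s t p1 p2) (fun p2 => H2357_phase_pt s t p1 p2)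
  (der_Hval_p2 s t p1 p2).
have pFs := sl _ _ _ _ _ _ (phase_pt_s s t p1 p2) (fun s => momentum_poly_phase_pt s t p1
  p2) (der_Fval_s s t p1 p2).
have pFt := sl _ _ _ _ _ _ (phase_pt_t s t p1 p2) (fun t => momentum_poly_phase_pt s t p1
  p2) (der_Fval_t s t p1 p2).
have pF1 := sl _ _ _ _ _ _ (phase_pt_p1 s t p1 p2) (fun p1 => momentum_poly_phase_pt s t p1
  p2) (der_Fval_p1 s t p1 p2).
have pF2 := sl _ _ _ _ _ _ (phase_pt_p2 s t p1 p2) (fun p2 => momentum_poly_phase_pt s t p1
  p2) (der_Fval_p2 s t p1 p2).
rewrite /poisson (bigD1 ord0) //= (bigD1 o1) //= big1 => [|i].
  by rewrite /partial pHs pHt pH1 pH2 pFs pFt pF1 pF2; ring.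
have inv (f : 'rV[R]_(7 + 7) -> R) (v z : 'rV[R]_(7 + 7)) : (forall h : R, f (h *: v + z) =
  f z) -> 'D_v f z = 0.
  move=> fv; have := @derive_slice _ _ f (fun h => h *: v + z) v 0.
  rewrite scale0r add0r => -> => [|h]; last by rewrite addr0.
  by rewrite (_ : _ \o _ = cst (f z)) ?derive_cst //; apply/funext.
move=> /andP[i0 i1].
have xpt (h : R) k : (k < 2)%N -> x_ k.+1 (h *: delta_mx 0 (lshift 7 i) + phase_pt s t p1
  p2) = x_ k.+1 (phase_pt s t p1 p2).
  move=> ltk; rewrite /x_ !mxE (inj_eq (@lshift_inj _ _)) eqxx /= (_ : _ == i = false)
    ?mulr0 ?add0r //.
  apply/negbTE; move: i0 i1; rewrite -!val_eqE /= inordK; last by apply: leq_trans ltk _.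
  by case: k ltk => [|[|k]] //= _; rewrite eq_sym // => _; rewrite eq_sym.
have ppt (h : R) k : p_ k (h *: delta_mx 0 (lshift 7 i) + phase_pt s t p1 p2) = p_ k
  (phase_pt s t p1 p2).
  by rewrite /p_ !mxE eq_rlshift andbF mulr0 add0r.
rewrite /partial !(inv _ (delta_mx 0 (lshift 7 i))) ?mulr0 ?mul0r ?subrr // => h.
  by rewrite /H2357 !xpt // !ppt.
apply: eq_bigr => tau _; congr (a _ _ * _); first by apply/rowP => j; rewrite !mxE xpt.
by apply: eq_bigr => j _; rewrite ppt.
Qed.

Hypothesis pois : forall z, poisson (@H2357 R) (momentum_poly a) z = 0.

(* The coefficient of [v_1 ^ i v_2 ^ j] in [Fval s t (v_1 + pot1 s t) (v_2 + pot2 s t)]. *)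
Definition vcoef i j s t := \sum_(tau : multi_index d | weight tau == d)
  coef_at tau s t * (central_monomial tau * (pot1 s t ^+ (tau ord0 - i) * 'C(tau ord0, i)%:R)
               * (pot2 s t ^+ (tau o1 - j) * 'C(tau o1, j)%:R)).

Definition vcoef_s i j s t : R := 'D_1 (vcoef i j ^~ t) s.
Definition vcoef_t i j s t : R := 'D_1 (vcoef i j s) t.

Lemma der_vcoef_s i j s t : is_derive s (1 : R) (vcoef i j ^~ t) (vcoef_s i j s t).
Proof.
apply: derivableP; apply: (@ex_derive _ _ _ _ _ _ _ (is_derive_bigf _)) => tau wt.
exact: (is_derive_mulf (der_coef_at_s s t wt) (is_derive_mulf (is_derive_mulf
  (is_derive_constf (central_monomial tau) s 1)
  (is_derive_mulf (is_derive_expf _ (der_pot1_s s t)) (is_derive_constf _ s 1)))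
  (is_derive_mulf (is_derive_expf _ (der_pot2_s s t)) (is_derive_constf _ s 1)))).
Qed.

Lemma der_vcoef_t i j s t : is_derive t (1 : R) (vcoef i j s) (vcoef_t i j s t).
Proof.
apply: derivableP; apply: (@ex_derive _ _ _ _ _ _ _ (is_derive_bigf _)) => tau wt.
exact: (is_derive_mulf (der_coef_at_t s t wt) (is_derive_mulf (is_derive_mulf
  (is_derive_constf (central_monomial tau) t 1)
  (is_derive_mulf (is_derive_expf _ (der_pot1_t s t)) (is_derive_constf _ t 1)))
  (is_derive_mulf (is_derive_expf _ (der_pot2_t s t)) (is_derive_constf _ t 1)))).
Qed.

Lemma vcoef_eq0 i j s t : (d < i + j)%N -> vcoef i j s t = 0.
Proof.
move=> ltd; apply: big1 => tau /eqP wt.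
have le : (tau ord0 + tau o1 <= d)%N.
  suff : (tau ord0 + tau o1 <= weight tau)%N by rewrite wt.
  by rewrite /weight (bigD1 ord0) //= leq_add2l (bigD1 o1) //= leq_addr.
have [lti|gei] := ltnP (tau ord0) i; first by rewrite (bin_small lti) !(mulr0, mul0r).
rewrite (@bin_small (tau o1) j) ?mulr0 // -(ltn_add2l (tau ord0)).
by apply: leq_ltn_trans le _; apply: leq_trans ltd _; rewrite leq_add2r.
Qed.

(** The outer variable is v_2, the inner one v_1. *)
Definition vpoly (c : nat -> nat -> R) : {poly {poly R}} :=
  \poly_(j < d.+1) \poly_(i < d.+1) c i j.

Lemma horner_vpoly c v1 v2 : (vpoly c).[v2%:P].[v1] =
  \sum_(j < d.+1) (\sum_(i < d.+1) c i j * v1 ^+ i) * v2 ^+ j.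
Proof.
rewrite horner_poly horner_sum; apply: eq_bigr => j _.
by rewrite hornerM horner_poly horner_exp hornerC.
Qed.

Lemma coef_vpoly c i j : (forall i j, (d < i + j)%N -> c i j = 0) -> (vpoly c)`_j`_i = c i j.
Proof.
move=> c0; rewrite coef_poly; case: ltnP => ltj; last by rewrite coef0 c0 //; lia.
by rewrite coef_poly; case: ltnP => lti //; rewrite c0 //; lia.
Qed.

Lemma expr_binomial_wide (x y : R) n : (n <= d)%N ->
  (x + y) ^+ n = \sum_(i < d.+1) y ^+ (n - i) * 'C(n, i)%:R * x ^+ i.
Proof.
move=> led; rewrite addrC exprDn (big_ord_widen d.+1 (fun i => y ^+ (n - i) * x ^+ i *+
  'C(n, i))) //.
rewrite big_mkcond; apply: eq_bigr => i _; case: ltnP => lti; first by rewrite -mulr_natr; ring.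
by rewrite bin_small // mulr0 mul0r.
Qed.

Lemma Fval_vpoly s t v1 v2 : Fval s t (v1 + pot1 s t) (v2 + pot2 s t) =
  (vpoly (fun i j => vcoef i j s t)).[v2%:P].[v1].
Proof.
rewrite horner_vpoly /Fval.
under eq_bigr => tau wt do rewrite (@expr_binomial_wide v1 _ (tau ord0)) ?leq_ord //
  (@expr_binomial_wide v2 _ (tau o1)) ?leq_ord //.
transitivity (\sum_(tau : multi_index d | weight tau == d) \sum_(j < d.+1) \sum_(i < d.+1)
    coef_at tau s t * (central_monomial tau * (pot1 s t ^+ (tau ord0 - i) * 'C(tau ord0, i)%:R)
               * (pot2 s t ^+ (tau o1 - j) * 'C(tau o1, j)%:R)) * v1 ^+ i * v2 ^+ j).
  apply: eq_bigr => tau wt; rewrite mulr_sumr mulr_suml mulr_sumr; apply: eq_bigr => j _.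
  by rewrite !mulr_suml mulr_sumr; apply: eq_bigr => i _; ring.
rewrite exchange_big; apply: eq_bigr => j _; rewrite exchange_big mulr_suml.
by apply: eq_bigr => i _; rewrite -!mulr_suml.
Qed.

Let Ftil s t v1 v2 := Fval s t (v1 + pot1 s t) (v2 + pot2 s t).

(** At fixed velocities the momenta move with the potentials, whence the last two terms. *)
Lemma der_Ftil_s s t v1 v2 (p1 := v1 + pot1 s t) (p2 := v2 + pot2 s t) :
  is_derive s (1 : R) (fun s => Ftil s t v1 v2)
    (Fval_s s t p1 p2 + Fval_p1 s t p1 p2 * pot1_s s t + Fval_p2 s t p1 p2 * pot2_s s t).
Proof.
rewrite /Fval_s /Fval_p1 /Fval_p2 !mulr_suml -!big_split; apply: is_derive_bigf => tau wt.
have D := is_derive_mulf (der_coef_at_s s t wt) (is_derive_mulf (is_derive_mulf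
  (is_derive_expf (tau ord0) (is_derive_addf (is_derive_constf v1 s 1) (der_pot1_s s t)))
  (is_derive_expf (tau o1) (is_derive_addf (is_derive_constf v2 s 1) (der_pot2_s s t))))
  (is_derive_constf (central_monomial tau) s 1)).
by apply: is_derive_eq D _; rewrite -/p1 -/p2 /=; ring.
Qed.

Lemma der_Ftil_t s t v1 v2 (p1 := v1 + pot1 s t) (p2 := v2 + pot2 s t) :
  is_derive t (1 : R) (fun t => Ftil s t v1 v2)
    (Fval_t s t p1 p2 + Fval_p1 s t p1 p2 * pot1_t s t + Fval_p2 s t p1 p2 * pot2_t s t).
Proof.
rewrite /Fval_t /Fval_p1 /Fval_p2 !mulr_suml -!big_split; apply: is_derive_bigf => tau wt.
have D := is_derive_mulf (der_coef_at_t s t wt) (is_derive_mulf (is_derive_mulf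
  (is_derive_expf (tau ord0) (is_derive_addf (is_derive_constf v1 t 1) (der_pot1_t s t)))
  (is_derive_expf (tau o1) (is_derive_addf (is_derive_constf v2 t 1) (der_pot2_t s t))))
  (is_derive_constf (central_monomial tau) t 1)).
by apply: is_derive_eq D _; rewrite -/p1 -/p2 /=; ring.
Qed.

Lemma der_vpoly (c : R -> nat -> nat -> R) (dc : nat -> nat -> R) (u v1 v2 : R) :
    (forall i j, is_derive u (1 : R) (fun u => c u i j) (dc i j)) ->
  is_derive u (1 : R) (fun u => (vpoly (c u)).[v2%:P].[v1]) (vpoly dc).[v2%:P].[v1].
Proof.
move=> Dc; rewrite horner_vpoly.
rewrite (_ : (fun u => _) = fun u => \sum_(j < d.+1) (\sum_(i < d.+1) c u i j * v1 ^+ i) *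
  v2 ^+ j).
  apply: is_derive_bigf => j _.
  have D (i : 'I_d.+1) : is_derive u (1 : R) (fun u => c u i j * v1 ^+ i) (dc i j * v1 ^+ i).
    have D := is_derive_mulf (Dc i j) (is_derive_constf (v1 ^+ i) u 1).
    by apply: is_derive_eq D _; rewrite mulr0 addr0.
  have D' := is_derive_mulf (is_derive_bigf (P := predT) (fun i _ => D i))
    (is_derive_constf (v2 ^+ j) u 1).
  by apply: is_derive_eq D' _; rewrite mulr0 addr0.
by apply/funext => y; rewrite horner_vpoly.
Qed.

Let vp s t := vpoly (fun i j => vcoef i j s t).

(** Both sides are the derivative in [s], at fixed velocities, of the same function, so the formula
    for [vcoef] need not be differentiated explicitly. *)
Lemma vpoly_s s t v1 v2 (p1 := v1 + pot1 s t) (p2 := v2 + pot2 s t) :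
  (vpoly (fun i j => vcoef_s i j s t)).[v2%:P].[v1] =
  Fval_s s t p1 p2 + Fval_p1 s t p1 p2 * pot1_s s t + Fval_p2 s t p1 p2 * pot2_s s t.
Proof.
apply: is_derive_unique (der_Ftil_s s t v1 v2).
rewrite (_ : (fun _ => _) = fun s => (vp s t).[v2%:P].[v1]).
  by apply: der_vpoly => i j; apply: der_vcoef_s.
by apply/funext => y; rewrite /Ftil Fval_vpoly.
Qed.

Lemma vpoly_t s t v1 v2 (p1 := v1 + pot1 s t) (p2 := v2 + pot2 s t) :
  (vpoly (fun i j => vcoef_t i j s t)).[v2%:P].[v1] =
  Fval_t s t p1 p2 + Fval_p1 s t p1 p2 * pot1_t s t + Fval_p2 s t p1 p2 * pot2_t s t.
Proof.
apply: is_derive_unique (der_Ftil_t s t v1 v2).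
rewrite (_ : (fun _ => _) = fun t => (vp s t).[v2%:P].[v1]).
  by apply: der_vpoly => i j; apply: der_vcoef_t.
by apply/funext => y; rewrite /Ftil Fval_vpoly.
Qed.

Lemma is_derive_translate (f : R -> R) c s b :
  is_derive (s + c) (1 : R) f b -> is_derive s (1 : R) (fun y => f (y + c)) b.
Proof.
have Zs (h : R) : (h + s) + c = h *: 1 + (s + c) by rewrite -addrA [_ *: 1]mulr1.
move=> D; apply: DeriveDef.
  exact: (@derivable_slice _ _ f (fun y => y + c) 1 s Zs).
by rewrite -(@derive_slice _ _ f (fun y => y + c) 1 s Zs) derive_val.
Qed.

Lemma vpoly_v1 s t v1 v2 (p1 := v1 + pot1 s t) (p2 := v2 + pot2 s t) :
  (map_poly (@deriv R) (vp s t)).[v2%:P].[v1] = Fval_p1 s t p1 p2.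
Proof.
apply: is_derive_unique (is_derive_translate (der_Fval_p1 s t p1 p2)).
rewrite (_ : (fun _ => _) = fun v1 => (vp s t).[v2%:P].[v1]); first exact: derive_poly2x.
by apply/funext => y; rewrite Fval_vpoly.
Qed.

Lemma vpoly_v2 s t v1 v2 (p1 := v1 + pot1 s t) (p2 := v2 + pot2 s t) :
  (vp s t)^`().[v2%:P].[v1] = Fval_p2 s t p1 p2.
Proof.
apply: is_derive_unique (is_derive_translate (der_Fval_p2 s t p1 p2)).
rewrite (_ : (fun _ => _) = fun v2 => (vp s t).[v2%:P].[v1]); first exact: derive_poly2y.
by apply/funext => y; rewrite Fval_vpoly.
Qed.

Definition curl s t := (curl_poly q3 q4 q5 q6 q7).[t%:P].[s].

(** The vanishing bracket at p = v + pot: once derivatives are taken at fixed velocities, the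
    potentials remain only through [pot1_t - pot2_s], which is the field. *)
Lemma vpoly_transport s t :
  ('X)%:P * vpoly (fun i j => vcoef_s i j s t) + 'X * vpoly (fun i j => vcoef_t i j s t)
  + (curl s t)%:P%:P * (('X)%:P * (vp s t)^`() - 'X * map_poly (@deriv R) (vp s t)) = 0.
Proof.
apply: poly2_ext => v2 v1.
rewrite !(hornerD, hornerN, hornerM, hornerC, hornerX) vpoly_s vpoly_t vpoly_v1 vpoly_v2.
have := pois (phase_pt s t (v1 + pot1 s t) (v2 + pot2 s t)); rewrite poisson_phase_pt
  !addrK => E.
have -> : curl s t = pot1_t s t - pot2_s s t.
  by rewrite /curl horner_curl_poly /pot1_t /pot2_s; field.
apply: etrans E; ring.
Qed.

Lemma vcoef_s_eq0 i j s t : (d < i + j)%N -> vcoef_s i j s t = 0.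
Proof.
move=> ltd; rewrite /vcoef_s (_ : vcoef i j ^~ t = cst 0) ?derive_cst //.
by apply/funext => y; rewrite vcoef_eq0.
Qed.

Lemma vcoef_t_eq0 i j s t : (d < i + j)%N -> vcoef_t i j s t = 0.
Proof.
move=> ltd; rewrite /vcoef_t (_ : vcoef i j s = cst 0) ?derive_cst //.
by apply/funext => y; rewrite vcoef_eq0.
Qed.

Lemma vcoef_transport i j s t :
  lag (fun k => vcoef_s k j s t) i + lag (fun k => vcoef_t i k s t) j
  + curl s t * (j.+1%:R * lag (fun k => vcoef k j.+1 s t) i
                 - i.+1%:R * lag (fun k => vcoef i.+1 k s t) j) = 0.
Proof.
have /(congr1 (fun p : {poly {poly R}} => p`_j`_i)) := vpoly_transport s t.
have c0 k l := @vcoef_eq0 k l s t; have c1 k l := @vcoef_s_eq0 k l s t.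
have c2 k l := @vcoef_t_eq0 k l s t.
rewrite !coef0 !(coefD, coefN, coefCM, coefXM) coef_deriv.
rewrite /vp; case: i j => [|i] [|j]; rewrite /= ?coef0 ?coefMn ?coef_map /= ?coef_deriv
  ?coef_vpoly //.
- by rewrite !mulr0.
- by rewrite mulr0 mul1r.
- by rewrite mulr0 mul1r.
by rewrite !mulr_natl.
Qed.

Lemma polyx_quadratic (c0 c1 c2 : R -> R) (h : R -> R -> R) :
  (forall s t, h s t = c0 t + c1 t * s + c2 t * s ^+ 2) -> polyx h.
Proof.
move=> hE; exists 2 => t; exists (Poly [:: c0 t; c1 t; c2 t]); first exact: size_Poly.
by move=> s; rewrite horner_Poly /= hE; ring.
Qed.

Lemma vcoef_poly i j : exists P : {poly {poly R}}, forall s t, vcoef i j s t = P.[t%:P].[s].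
Proof.
apply: polyx_polyy_poly.
  apply: (@transport_polyx R d curl vcoef vcoef_s vcoef_t).
  - apply: (@polyx_quadratic (fun t => q3 + q5 * t - q6 / 2 * t ^+ 2) (fun t => q4 + q7 * t)
      (fun=> q6 / 2)) => s t; rewrite /curl horner_curl_poly; ring.
  - exact: der_vcoef_s.
  - exact: der_vcoef_t.
  - by move=> *; apply: vcoef_eq0.
  - exact: vcoef_transport.
(* Exchanging x_1 with x_2 and v_1 with v_2 reverses the orientation, hence the sign of the
   field. *)
apply: (@transport_polyx R d (fun t s => - curl s t) (fun j i t s => vcoef i j s t)
   (fun j i t s => vcoef_t i j s t) (fun j i t s => vcoef_s i j s t)).
- apply: (@polyx_quadratic (fun s => - (q3 + q4 * s + q6 / 2 * s ^+ 2)) (fun s => - (q5 +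
  q7 * s))
      (fun=> q6 / 2)) => t s; rewrite /curl horner_curl_poly; ring.
- by move=> *; apply: der_vcoef_t.
- by move=> *; apply: der_vcoef_s.
- by move=> *; apply: vcoef_eq0; rewrite addnC.
- by move=> k l t s; rewrite -[RHS](vcoef_transport l k s t); ring.
Qed.

Lemma vcoef_const : q6 ^+ 2 + q7 ^+ 2 != 0 ->
  exists k : nat -> R, forall m j s t, (j <= m)%N ->
    vcoef (m - j) j s t = (if odd m then 0 else k m./2 *: (1 + 'X^2) ^+ m./2 : {poly R})`_j.
Proof.
move=> q67.
have /choice[G GE] : forall ij : nat * nat, exists P : {poly {poly R}},
    forall s t, vcoef ij.1 ij.2 s t = P.[t%:P].[s].
  by move=> ij; apply: vcoef_poly.
have G1 i j s t : vcoef_s i j s t = (map_poly (@deriv R) (G (i, j))).[t%:P].[s].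
  apply: is_derive_unique (der_vcoef_s i j s t) _.
  rewrite (_ : _ ^~ t = fun s => (G (i, j)).[t%:P].[s]); first exact: derive_poly2x.
  by apply/funext => y; rewrite -GE.
have G2 i j s t : vcoef_t i j s t = (G (i, j))^`().[t%:P].[s].
  apply: is_derive_unique (der_vcoef_t i j s t) _.
  rewrite (_ : vcoef i j s = fun t => (G (i, j)).[t%:P].[s]); first exact: derive_poly2y.
  by apply/funext => y; rewrite -GE.
have [||k kE] := @integral_coefs R R[i] (real_complex R) q3 q4 q5 q6 q7 d
  (fun i j => G (i, j)) q67.
- by move=> i j ltd; apply: poly2_ext => t s; rewrite -GE /= vcoef_eq0 // !horner0.
- move=> i j; have ev (f : nat -> {poly {poly R}}) n s t : (lag f n).[t%:P].[s] = lag (fun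
  k => (f k).[t%:P].[s]) n.
    by case: n => //=; rewrite !horner0.
  have BE u v : curl u v = (curl_poly q3 q4 q5 q6 q7).[v%:P].[u] by [].
  move: (curl_poly q3 q4 q5 q6 q7) BE => B BE.
  apply: poly2_ext => t s; rewrite !(hornerD, hornerN, hornerM, ev) !horner0.
  rewrite -[RHS](vcoef_transport i j s t) -!polyC_natr !hornerC.
  congr (_ + _ + _ * (_ * _ - _ * _)).
  + by case: i => //= k; rewrite G1.
  + by case: j => //= k; rewrite G2.
  + by rewrite BE.
  + by case: i => //= k; rewrite -GE.
  + by case: j => //= k; rewrite -GE.
exists k => m j s t lejm.
by have := GE ((m - j)%N, j) s t; rewrite /= kE // !hornerC.
Qed.

(** The potentials vanish at the origin, so velocities are momenta there and only the exponents (n,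
    0) of (p_1, p_2) contribute. *)
Lemma vcoef_origin n : vcoef n 0 0 0 = \sum_(tau : multi_index d | weight tau == d)
  coef_at tau 0 0 * central_monomial tau * ((tau ord0 == n :> nat) && (tau o1 == 0 :> nat))%:R.
Proof.
have al10 : pot1 0 0 = 0 by rewrite /pot1; ring.
have al20 : pot2 0 0 = 0 by rewrite /pot2; ring.
(* For m < k the truncated power is 1, but the binomial coefficient is 0. *)
have pw m k : (0 : R) ^+ (m - k) * 'C(m, k)%:R = (m == k)%:R.
  rewrite expr0n subn_eq0; case: (ltngtP m k) => [lt|lt|->]; last by rewrite binn mulr1.
    by rewrite bin_small // mulr0.
  by rewrite mul0r.
apply: eq_bigr => tau _; rewrite al10 al20 !pw -mulnb natrM; ring.
Qed.

(** F as a function of the energy [h] and of p_3, ..., p_7, read off at x = 0 and p_2 = 0, where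
    p_1^2 = 2 h. Unlike the constants of [vcoef_const], obtained for each [q] separately, it visibly
    depends on [q] polynomially. *)
Definition Theta h := \sum_(tau : multi_index d | weight tau == d)
  coef_at tau 0 0 * central_monomial tau *
  (if odd (tau ord0) || (tau o1 != 0 :> nat) then 0 else (h *+ 2) ^+ (tau ord0)./2).

(** By [vcoef_const], F is the sum of the k_m (v_1^2 + v_2^2)^m, with v_1^2 + v_2^2 = 2 H, and k_m
    is the coefficient of v_1^(2m), which may be taken at the origin. *)
Lemma Fval_Theta s t p1 p2 : q6 ^+ 2 + q7 ^+ 2 != 0 ->
  Fval s t p1 p2 = Theta (Hval s t p1 p2).
Proof.
move=> /vcoef_const[k kE].
rewrite -[p1 in LHS](subrK (pot1 s t)) -[p2 in LHS](subrK (pot2 s t)) Fval_vpoly horner_vpoly.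
set v1 := p1 - _; set v2 := p2 - _.
have wE : v1 ^+ 2 + v2 ^+ 2 = Hval s t p1 p2 *+ 2.
  by rewrite /Hval -/v1 -/v2 -mulr_natr mulrAC mulVf ?mul1r // pnatr_eq0.
transitivity (\sum_(n < d.+1) (if odd n then 0 else vcoef n 0 0 0 * (Hval s t p1 p2 *+ 2)
  ^+ n./2)).
  under eq_bigr => j _ do rewrite mulr_suml.
  rewrite (sum_antidiagonals (b := fun i j => vcoef i j s t * v1 ^+ i * v2 ^+ j)); last first.
    by move=> i j ltd; rewrite vcoef_eq0 // !mul0r.
  apply: eq_bigr => n _.
  have kn : vcoef n 0 0 0 = (if odd n then 0 else k n./2).
    rewrite -{1}[n : nat]subn0 kE //; case: (odd n); first by rewrite coef0.
    by rewrite coefZ coef_1X2_exp mulr1.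
  rewrite (eq_bigr (fun j : 'I_n.+1 => (if odd n then 0 else k n./2 *: (1 + 'X^2) ^+ n./2 :
    {poly R})`_j
      * v1 ^+ (n - j) * v2 ^+ j)) => [|j _]; last by rewrite (kE n j s t (leq_ord j)).
  rewrite kn; case: (boolP (odd n)) => [on|en].
    by apply: big1 => j _; rewrite coef0 !mul0r.
  rewrite -wE -homogenize_1X2 mulr_sumr even_halfK //; apply: eq_bigr => j _.
  by rewrite coefZ -!mulrA.
rewrite /Theta; under eq_bigr => n _ do rewrite vcoef_origin mulr_suml -(fun_if (fun x => x)).
transitivity (\sum_(n < d.+1) \sum_(tau : multi_index d | weight tau == d)
   coef_at tau 0 0 * central_monomial tau *
   (if odd n || (tau o1 != 0 :> nat) then 0 else (Hval s t p1 p2 *+ 2) ^+ n./2) * (tau ord0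
     == n :> nat)%:R).
  apply: eq_bigr => n _; case: (boolP (odd n)) => on.
    by rewrite big1 // => tau _; rewrite mulr0 mul0r.
  apply: eq_bigr => tau _; rewrite /=; case: (tau o1 == 0 :> nat); rewrite ?andbT ?andbF
    /=; ring.
rewrite exchange_big; apply: eq_bigr => tau _.
rewrite (bigD1 (tau ord0)) //= eqxx mulr1 big1 ?addr0 // => n.
by rewrite -val_eqE /= eq_sym => /negPf->; rewrite mulr0.
Qed.

End Phase.

(** * Extension to the momenta with p_6 = p_7 = 0 *)

Section Dependence.
Variables (R : realType) (d : nat) (a : multi_index d -> 'rV[R]_2 -> R).
Hypothesis sm : forall tau, weight tau = d -> smooth (a tau).
Hypothesis pois : forall z, poisson (@H2357 R) (momentum_poly a) z = 0.

(** With the other momenta fixed, [Fval_Theta] applies whenever p_6 is nonzero, and a polynomial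
    identity extends to p_6 = 0. *)
Lemma Fval_Theta_all (q : 'I_7 -> R) s t p1 p2 :
  Fval a q s t p1 p2 = Theta a q (Hval q s t p1 p2).
Proof.
pose qu u := fun i : 'I_7 => if i == inord 5 then u else q i.
have qE : q = qu (q (inord 5)).
  by apply/funext => i; rewrite /qu; case: eqP => [->|].
pose f u := Fval a (qu u) s t p1 p2 - Theta a (qu u) (Hval (qu u) s t p1 p2).
suff : f (q (inord 5)) = 0 by rewrite /f -qE => /subr0_eq.
have qp i : is_poly (fun u => qu u i).
  rewrite /qu; case: eqP => _; last exact: is_polyC.
  by exists 'X => u; rewrite hornerX.
(* Both sides are polynomials in [p_6]. *)
apply: (@is_poly_eq0 _ f) => [|u u0].
  have cof tau : is_poly (fun u => @central_monomial R d (qu u) tau).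
    by apply: is_poly_prod => i; apply: is_polyX.
  have Hp : is_poly (fun u => Hval (qu u) s t p1 p2).
    have lin (c0 c1 c2 c3 c4 : R) : is_poly (fun u => c0 * qu u (inord 2) + c1 * qu u (inord 3)
        + c2 * qu u (inord 4) + c3 * qu u (inord 5) + c4 * qu u (inord 6)).
      have m c i : is_poly (fun u => c * qu u i) by apply: is_polyM => //; apply: is_polyC.
      by apply: (is_polyD (is_polyD (is_polyD (is_polyD _ _) _) _) _); apply: m.
    have a1p : is_poly (fun u => pot1 (qu u) s t).
      have [p pE] := lin (2^-1 * t) (s * t) 0 (2^-1 * s ^+ 2 * t) (4^-1 * s * t ^+ 2).
      by exists p => u; rewrite -pE /pot1; ring.
    have a2p : is_poly (fun u => pot2 (qu u) s t).
      have [p pE] := lin (- (2^-1 * s)) 0 (- (s * t)) (2^-1 * s * t ^+ 2) (- (4^-1 * s ^+ 2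
        * t)).
      by exists p => u; rewrite -pE /pot2; ring.
    apply: is_polyM; first exact: is_polyC.
    by apply: is_polyD; apply: is_polyX; (apply: is_polyD; [exact: is_polyC|exact: is_polyN]).
  apply: is_polyD; last apply: is_polyN.
    apply: is_poly_sum => tau; apply: is_polyM; first exact: is_polyC.
    by apply: is_polyM => //; exact: is_polyC.
  apply: is_poly_sum => tau; apply: is_polyM.
    by apply: is_polyM => //; exact: is_polyC.
  case: (odd _ || _); first exact: is_polyC.
  by apply: is_polyX; apply: is_polyD.
rewrite /f Fval_Theta ?subrr //= /qu.
have -> : (inord 6 == inord 5 :> 'I_7) = false by rewrite -val_eqE /= !inordK.
by rewrite eqxx gt_eqF // ltr_wpDr ?sqr_ge0 // exprn_even_gt0.
Qed.

End Dependence.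

(** * Functional dependence *)

Section Differentiability.
Variables (R : realType) (V : normedModType R).
Implicit Types (f g : V -> R) (z : V).

Lemma differentiable_constf (c : R) z : differentiable (fun _ : V => c) z.
Proof. exact: differentiable_cst. Qed.

Lemma differentiable_addf f g z : differentiable f z -> differentiable g z ->
  differentiable (fun y => f y + g y) z.
Proof. exact: differentiableD. Qed.

Lemma differentiable_oppf f z : differentiable f z -> differentiable (fun y => - f y) z.
Proof. exact: differentiableN. Qed.

Lemma differentiable_mulf f g z : differentiable f z -> differentiable g z ->
  differentiable (fun y => f y * g y) z.
Proof. exact: differentiableM. Qed.

Lemma differentiable_expf f n z : differentiable f z -> differentiable (fun y => f y ^+ n) z.
Proof.
move=> df; elim: n => [|n IHn]; first exact: differentiable_constf.
rewrite (_ : (fun _ => _) = fun y => f y * f y ^+ n); first exact: differentiable_mulf.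
by apply/funext => y; rewrite exprS.
Qed.

Lemma differentiable_sumf (I : finType) (P : pred I) (f : I -> V -> R) z :
  (forall i, differentiable (f i) z) -> differentiable (fun y => \sum_(i | P i) f i y) z.
Proof.
move=> df; rewrite (_ : (fun _ => _) = \sum_(i | P i) f i); last first.
  by apply/funext => y; rewrite fct_sumE.
by elim/big_ind: _ => [|g h|i _]; [exact: differentiable_cst|exact: differentiableD|exact: df].
Qed.

Lemma differentiable_prodf (I : finType) (P : pred I) (f : I -> V -> R) z :
  (forall i, differentiable (f i) z) -> differentiable (fun y => \prod_(i | P i) f i y) z.
Proof.
move=> df; rewrite (_ : (fun _ => _) = \big[(fun g h y => g y * h y)/(fun=> 1)]_(i | P i) f
  i); last first.
  by apply/funext => y; elim/big_rec2: _ => // i g c _ <-.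
by elim/big_ind: _ => [|g h|i _]; [exact: differentiable_cst|exact:
  differentiable_mulf|exact: df].
Qed.

Lemma differentiable_rowf n (f : 'I_n -> V -> R) z : (forall j, differentiable (f j) z) ->
  differentiable (fun y => \row_j f j y) z.
Proof.
move=> df; rewrite (_ : (fun _ => _) = \sum_(j < n) (fun y => f j y *: delta_mx 0 j)).
  by apply: differentiable_sum => j; apply: differentiableZl.
apply/funext => y; rewrite fct_sumE [LHS]row_sum_delta.
by apply: eq_bigr => j _; rewrite mxE.
Qed.

End Differentiability.

(** By the chain rule the Jacobian matrix factors through dimension [m]. *)
Lemma rank_jacobian_comp (R : realType) (n m k : nat) (f : 'rV[R]_n -> 'rV[R]_m)
    (g : 'rV[R]_m -> 'rV[R]_k) z : differentiable f z -> differentiable g (f z) ->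
  (\rank (jacobian (g \o f) z) <= m)%N.
Proof.
move=> df dg; have -> : jacobian (g \o f) z = jacobian f z *m jacobian g (f z).
  apply/row_matrixP => i; rewrite !rowE mulmxA /jacobian !mul_rV_lin1.
  by rewrite diff_comp.
exact: leq_trans (mxrankM_maxl _ _) (rank_leq_col _).
Qed.

Section Rank.
Variables (R : realType) (d : nat) (a : multi_index d -> 'rV[R]_2 -> R).
Hypothesis sm : forall tau, weight tau = d -> smooth (a tau).
Hypothesis pois : forall z, poisson (@H2357 R) (momentum_poly a) z = 0.

(** Replacing x_3, ..., x_7 by 0 changes neither F nor H, which reduces the claim to the points
    [phase_pt]. *)
Lemma momentum_poly_Theta (z : 'rV[R]_(7 + 7)) :
  momentum_poly a z = Theta a (fun i => p_ i.+1 z) (H2357 z).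
Proof.
pose z' := phase_pt (fun i => p_ i.+1 z) (x_ 1 z) (x_ 2 z) (p_ 1 z) (p_ 2 z).
have xE k : (k < 2)%N -> x_ k.+1 z = x_ k.+1 z'.
  by case: k => [|[|k]] // _; rewrite /z' x_phase_pt.
have pE (i : 'I_7) : p_ i.+1 z = p_ i.+1 z'.
  by rewrite /z' p_phase_pt; case: i => -[|[|i]].
have -> : momentum_poly a z = momentum_poly a z'.
  apply: eq_bigr => tau _; congr (a _ _ * _).
    by apply/rowP => j; rewrite !mxE xE.
  by apply: eq_bigr => i _; rewrite pE.
have -> : H2357 z = H2357 z'.
  have pE' k : (k < 7)%N -> p_ k.+1 z = p_ k.+1 z' by move=> lk; apply: (pE (Ordinal lk)).
  by rewrite /H2357 !xE // !pE'.
by rewrite momentum_poly_phase_pt H2357_phase_pt (Fval_Theta_all sm pois).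
Qed.

(* The seven functions are [full \o base], hence factor through ['rV_6]. *)
Let base (z : 'rV[R]_(7 + 7)) : 'rV[R]_6 := \row_(j < 6) if j == 0 then H2357 z else p_ j.+2 z.
Let full (y : 'rV[R]_6) : 'rV[R]_7 :=
  \row_(j < 7) if (j < 6)%N then y 0 (inord j) else Theta a (fun i => y 0 (inord i.-1)) (y 0 0).

Lemma differentiable_x k z : differentiable (@x_ R k) z.
Proof. exact: differentiable_coord. Qed.

Lemma differentiable_p k z : differentiable (@p_ R k) z.
Proof. exact: differentiable_coord. Qed.

Lemma differentiable_H z : differentiable (@H2357 R) z.
Proof.
rewrite /H2357; repeat first [exact: differentiable_constf | exact: differentiable_x
  | exact: differentiable_p | apply: differentiable_addf | apply: differentiable_oppf
  | apply: differentiable_mulf | apply: differentiable_expf].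
Qed.

Lemma independent_at_false z : ~ independent_at
  [tuple @H2357 R; p_ 3; p_ 4; p_ 5; p_ 6; p_ 7; momentum_poly a] z.
Proof.
rewrite /independent_at (_ : (fun _ => _) = full \o base).
  (* The rank is at most 6, hence less than 7. *)
  apply/eqP; rewrite neq_ltn; apply/orP; left; rewrite ltnS; apply: rank_jacobian_comp.
    apply: differentiable_rowf => j; case: (j == 0); first exact: differentiable_H.
    exact: differentiable_p.
  apply: differentiable_rowf => j; case: (j < 6)%N; first exact: differentiable_coord.
  apply: differentiable_sumf => tau; apply: differentiable_mulf.
    apply: differentiable_mulf; first exact: differentiable_constf.
    by apply: differentiable_prodf => i; apply: differentiable_expf; exact:
      differentiable_coord.
  case: (odd _ || _); first exact: differentiable_constf.
  by apply: differentiable_expf; apply: differentiable_addf; exact: differentiable_coord.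
have baseE y k : (k < 6)%N -> base y 0 (inord k) = if k == 0%N then H2357 y else p_ k.+2 y.
  by move=> ltk; rewrite mxE -val_eqE /= inordK.
apply/funext => y; apply/rowP => j; rewrite mxE [RHS]mxE.
case: (ltnP j 6) => [ltj|gej].
  by rewrite baseE //; move: ltj; case: j => -[|[|[|[|[|[|j]]]]]] ltj.
have -> : j = ord_max by apply/val_inj/eqP; rewrite eqn_leq gej -ltnS ltn_ord.
rewrite (tnth_nth (@H2357 R)) /= momentum_poly_Theta /Theta.
have -> : base y 0 0 = H2357 y by rewrite mxE.
apply: eq_bigr => tau _; congr (_ * _ * _).
(* For the indices i >= 2 of [central_monomial], p_(i+1) is entry i - 1 of [base y]. *)
apply: eq_bigr => i lti; rewrite baseE; last by case: i lti => -[|[|[|[|[|[|[|i]]]]]]].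
by case: i lti => -[|[|i]].
Qed.

End Rank.

(** * Volume of covers by boxes *)

Section NullSets.
Local Open Scope classical_set_scope.
Local Open Scope ring_scope.

(* By induction on [n], integrating over the first coordinate the inequality for the
   slices; [w] marks the boxes in use, those which the slice meets. *)
Lemma box_cover_volume (R : realType) (n : nat) (l u : nat -> 'I_n -> R) (w : nat -> bool) :
    (forall k i, l k i <= u k i) ->
    (forall z : 'I_n -> R, (forall i, 0 <= z i <= 1) ->
       exists2 k, w k & forall i, l k i <= z i <= u k i) ->
  (1 <= \sum_(0 <= k <oo) ((w k)%:R * \prod_(i < n) (u k i - l k i))%:E)%E.
Proof.
elim: n l u w => [|n IHn] l u w lu cov.
  (* In dimension 0 every box has volume 1, the empty product, so one box in use suffices. *)
  have [|k wk _] := cov (fun=> 0); first by case.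
  apply: le_trans (nneseries_lim_ge k.+1 _) => [|i _ _]; last first.
    by rewrite lee_fin mulr_ge0 ?ler0n // prodr_ge0 // => -[].
  rewrite big_nat_recr //= big_ord0 wk mulr1 sumEFin -EFinD lee_fin.
  by rewrite lerDr sumr_ge0 // => i _; rewrite big_ord0 mulr1 ler0n.
pose c k : R := (w k)%:R * \prod_(i < n) (u k (lift ord0 i) - l k (lift ord0 i)).
pose I k : set R := [set` `[l k ord0, u k ord0]].
have c0 k : 0 <= c k by rewrite mulr_ge0 ?ler0n // prodr_ge0 // => i _; rewrite subr_ge0.
pose f k (t : R) : \bar R := (c k * \1_(I k) t)%:E.
have f0 k t : (0 <= f k t)%E by rewrite lee_fin mulr_ge0 // indicE ler0n.
have mI k : measurable (I k) by exact: measurable_itv.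
pose D : set R := [set` `[0, 1]].
have mD : measurable D by exact: measurable_itv.
have mf k : measurable_fun D (f k).
  by apply/measurable_EFinP; apply: measurable_funM => //; exact: measurable_indic.
(* For fixed [t] the boxes in use whose first side contains [t] cover the unit cube of dimension
   [n]. *)
have f1 t : D t -> (1 <= \sum_(0 <= k <oo) f k t)%E.
  move=> Dt; pose w' k := w k && (l k ord0 <= t <= u k ord0).
  apply: le_trans (IHn (fun k i => l k (lift ord0 i)) (fun k i => u k (lift ord0 i)) w' _ _) _.
  - by move=> k i; apply: lu.
  - move=> z z01; have [|k wk zk] := cov (fun i => if unlift ord0 i is Some j then z j else t).
      by move=> i; case: unliftP => [j _|_] //; move: Dt; rewrite /D /= in_itv.
    exists k; first by rewrite /w' wk; have := zk ord0; rewrite unlift_none.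
    by move=> i; have := zk (lift ord0 i); rewrite liftK.
  - rewrite le_eqVlt; apply/orP; left; apply/eqP; apply: eq_eseriesr => k _.
    rewrite /f /c /w' indicE; congr EFin; rewrite -mulnb natrM mulrAC; congr (_ * _ * _).
    by congr (_%:R); rewrite mem_setE /I /= in_itv.
have mu1 : lebesgue_measure D = 1%E.
  by rewrite lebesgue_measure_itv /= lte_fin ltr01 oppr0 adde0.
apply: (@le_trans _ _ (\int[lebesgue_measure]_(t in D) (\sum_(0 <= k <oo) f k t))%E).
  have I1 : (\int[lebesgue_measure]_(t in D) cst 1%E t = 1)%E.
    by rewrite integral_cst // mul1e; exact: mu1.
  rewrite -[X in (X <= _)%E]I1; apply: ge0_le_integral => //.
  by apply: ge0_emeasurable_sum => [k t _ _|k _]; [exact: f0|exact: mf].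
rewrite integral_nneseries //; apply: lee_nneseries => [k _ _|k _].
  by apply: integral_ge0 => t _.
have -> : (\int[lebesgue_measure]_(t in D) f k t =
    (c k)%:E * \int[lebesgue_measure]_(t in D) (\1_(I k) t)%:E)%E.
  apply: (ge0_integralZl_EFin lebesgue_measure mD (f1 := fun t => (\1_(I k) t)%:E)) => [t Dt||].
  - by rewrite lee_fin indicE ler0n.
  - by apply/measurable_EFinP; apply: measurable_indic; exact: mI.
  - exact: c0.
rewrite integral_indic; [|exact: mD|exact: mI].
rewrite big_ord_recl mulrCA [X in (_ <= X)%E]EFinM [X in (_ <= X)%E]muleC.
rewrite lee_wpmul2l ?lee_fin //.
apply: (@le_trans _ _ (lebesgue_measure (I k))).
  by apply: le_measure; rewrite ?inE; [apply: measurableI; [exact: mI|exact: mD]|exact: mI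
    |exact: subIsetl].
rewrite /I lebesgue_measure_itv /= lte_fin; case: ltP => _; first by rewrite -EFinB.
by rewrite lee_fin subr_ge0.
Qed.

(** A cover of the space covers the unit cube, so its total volume is at least 1 and exceeds 1/2. *)
Lemma full_space_not_null (R : realType) (n : nat) : ~ Defs.null_set [set: 'rV[R]_n].
Proof.
move=> /(_ 2^-1)[|l [u [lu cov small]]]; first by rewrite invr_gt0.
have : (1 <= \sum_(0 <= k <oo) (true%:R * \prod_(i < n) (u k 0 i - l k 0 i))%:E)%E.
  apply: (@box_cover_volume R n (fun k => l k 0) (fun k => u k 0) (fun=> true)) => // z _.
  have [k _ kz] := cov (\row_i z i) I; exists k => // i.
  by have := kz i; rewrite mxE.
under eq_eseriesr => k _ do rewrite mul1r.
by move=> /le_trans/(_ small); rewrite lee_fin leNgt invf_lt1 ?ltr0n // ltr1n.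
Qed.

End NullSets.

Theorem theorem2 (R : realType) (d : nat) (hd : (1 <= d <= 6)%N) :
  ~ exists a : multi_index d -> 'rV[R]_2 -> R,
      let F := momentum_poly a in
      [/\ forall tau : multi_index d, weight tau = d -> smooth (a tau),
          forall z : 'rV[R]_(7 + 7), poisson (@H2357 R) F z = 0%R
        & independent_ae
            [tuple @H2357 R; p_ 3; p_ 4; p_ 5; p_ 6; p_ 7; F]].
Proof.
move=> [a [sm pois ind]]; apply: (@full_space_not_null R (7 + 7)).
(* The differentials are dependent at every point, so the exceptional set is the whole space. *)
suff <- : [set z | ~ independent_at
  [tuple @H2357 R; p_ 3; p_ 4; p_ 5; p_ 6; p_ 7; momentum_poly a] z]%classic = setT by [].
by apply/seteqP; split=> // z _; apply: independent_at_false.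
Qed.
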